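(* Let $(M,E)$ be a Finsler space, let $P$ be the hv-curvature of its Cartan connection, and let the index of nullity $\mu_P$ be constant on an open subset $U$ of $TM$. The nullity distribution $\mathcal{N}_P$ is completely integrable on $U$ if and only if, for all $X,Y\in\mathcal{N}_P$, $$\mathfrak{R}(X,Y)=0\quad\text{and}\quad (D_{JZ}R)(X,Y)=R(Y,F\mathcal{C}(X,Z))-R(X,F\mathcal{C}(Y,Z))$$ for every vector field $Z$ on $TM$.
   Context: Setting (Klein–Grifone approach). $M$ is a smooth $n$-dimensional manifold, $\mathcal{T}M\subset TM$ is the bundle of nonzero tangent vectors, and $X,Y,Z$ denote vector fields on $TM$ (objects are smooth on $\mathcal{T}M$). $J$ is the natural almost tangent structure of $TM$ (locally $J\partial_{x^i}=\partial_{y^i}$, $J\partial_{y^i}=0$), $C$ is the Liouville vector field (locally $y^i\partial_{y^i}$), and $V(TM)=\operatorname{Im}J=\ker J$. A Finsler space $(M,E)$ is given by $E:TM\to\mathbb{R}$ with $E>0$ on $\mathcal{T}M$, $E(0)=0$, $E$ of class $C^\infty$ on $\mathcal{T}M$ and $C^1$ on $TM$, $\mathcal{L}_CE=2E$, and $\Omega:=dd_JE$ (where $d_JE=dE\circ J$) of maximal rank. The canonical spray $S$ is defined by $i_S\Omega=-dE$. The Barthel connection is $\Gamma=[J,S]$, i.e. $\Gamma X=[JX,S]-J[X,S]$. Put $h=\frac12(I+\Gamma)$, $v=\frac12(I-\Gamma)$, and $H(TM)=\operatorname{Im}h$ (rank $n$). The curvature of the Barthel connection is $\mathfrak{R}=-\frac12[h,h]$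 (equivalently $\mathfrak{R}(X,Y)=-v[hX,hY]$). The almost complex structure $F$ is defined by $FJ=h$, $Fh=-J$. The metric $g$ is $g(X,Y)=\Omega(X,FY)$, so that $g(JX,JY)=\Omega(JX,Y)$. The Berwald connection $D^\circ$ is the linear connection on $TM$ with $D^\circ_{JX}JY=J[JX,Y]$, $D^\circ_{hX}JY=v[hX,JY]$, $D^\circ F=0$. The first and second Cartan tensors $\mathcal{C},\mathcal{C}'$ are the symmetric semi-basic (vertical-valued) tensors given by $\Omega(\mathcal{C}(X,Y),Z)=\frac12(\mathcal{L}_{JX}(J^*g))(Y,Z)$ and $\Omega(\mathcal{C}'(X,Y),Z)=\frac12(\mathcal{L}_{hX}g)(JY,JZ)$, where $(J^*g)(Y,Z)=g(JY,JZ)$. The Cartan connection $D$ is the linear connection on $TM$ with $D_{JX}JY=D^\circ_{JX}JY+\mathcal{C}(X,Y)$, $D_{hX}JY=D^\circ_{hX}JY+\mathcal{C}'(X,Y)$, $DF=0$. With $K(A,B)=[D_A,D_B]-D_{[A,B]}$ the curvature of $D$, the h-curvature and hv-curvature are $R(X,Y)Z=K(hX,hY)JZ$ and $P(X,Y)Z=K(hX,JY)JZ$. The nullity space of $P$ at $z$ is $\mathcal{N}_P(z)=\{X\in H_z(TM): P(X,Y)=0\ \forall\,Y\in T_z(TM)\}$, and $\mu_P(z)=\dim\mathcal{N}_P(z)$. Where $\mu_P$ is constant, $z\mapsto\mathcal{N}_P(z)$ is the nullity distribution $\mathcal{N}_P$; $X\in\mathcal{N}_P$ means that $X$ is a vector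 field with values in $\mathcal{N}_P$. Completely integrable means: $X,Y\in\mathcal{N}_P$ implies $[X,Y]\in\mathcal{N}_P$. *)

(* Defs.v *)
From mathcomp Require Import all_boot all_order all_algebra.
From mathcomp Require Import all_classical all_reals all_analysis.
Import Order.TTheory GRing.Theory Num.Theory.
Import numFieldNormedType.Exports.

Set Implicit Arguments.
Unset Strict Implicit.
Unset Printing Implicit Defensive.

Local Open Scope classical_set_scope.
Local Open Scope ring_scope.

(* In finite dimension, being C^(k+1) on an open set O amounts to being
   differentiable on O with all directional derivatives of class C^k on O. *)
Fixpoint Ck (R : realType) (V W : normedModType R) (k : nat) (O : set V)
    (f : V -> W) : Prop :=
  match k with
  | 0 => {in O, continuous f}
  | k'.+1 => (forall p, O p -> differentiable f p) /\
             (forall v : V, Ck k' O ('D_v f))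
  end.

(* An atlas of charts [phi i : dom i -> 'rV[R]_m] with local inverses [psi i],
   together with the choice of a preferred chart around each point. Tangent
   vectors at [z] are identified with their components in the preferred chart
   [chart_at z], so that every tangent space is 'rV[R]_m. *)
Record atlas (R : realType) (m : nat) (T : Type) := Atlas {
  idx : Type;
  chart_at : T -> idx;
  dom : idx -> set T;
  phi : idx -> T -> 'rV[R]_m;
  psi : idx -> 'rV[R]_m -> T }.
Arguments idx {R m T} _.
Arguments chart_at {R m T} _ _.
Arguments dom {R m T} _ _ _.
Arguments phi {R m T} _ _ _.
Arguments psi {R m T} _ _ _.

Record smooth_manifold (R : realType) (n : nat) (M : topologicalType)
    (A : atlas R n M) : Prop := SmoothManifold {
  _ : hausdorff_space M;
  _ : @second_countable M;
  _ : forall x, dom A (chart_at A x) x;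
  _ : forall i, open (dom A i);
  _ : forall i, open (phi A i @` dom A i);
  _ : forall i x, dom A i x -> psi A i (phi A i x) = x;
  _ : forall i, {in dom A i, continuous (phi A i)};
  _ : forall i, {in phi A i @` dom A i, continuous (psi A i)};
  _ : forall i j k,
        Ck k (phi A i @` (dom A i `&` dom A j)) (phi A j \o psi A i) }.

Section Calculus.
Context {R : realType} {m : nat} {T : Type} (A : atlas R m T).

Definition open_in (W : set T) : Prop :=
  forall i, open (phi A i @` (W `&` dom A i)).

Definition Ck_fun (V : normedModType R) (k : nat) (W : set T) (f : T -> V) :=
  forall i, Ck k (phi A i @` (W `&` dom A i)) (f \o psi A i).

Definition smooth_fun (W : set T) (f : T -> R^o) := forall k, Ck_fun k W f.

(* Components in the chart j of the tangent vector at z whose components in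
   the chart i are v. *)
Definition tcoord (i j : idx A) (z : T) (v : 'rV[R]_m) : 'rV[R]_m :=
  'D_v (phi A j \o psi A i) (phi A i z).

(* A vector field is a total function; only its values on the open set where
   it is smooth matter. *)
Definition vf := T -> 'rV[R]_m.

Definition local_rep (i : idx A) (X : vf) (q : 'rV[R]_m) : 'rV[R]_m :=
  let z := psi A i q in tcoord (chart_at A z) i z (X z).

Definition smooth_vf (W : set T) (X : vf) :=
  forall i k, Ck k (phi A i @` (W `&` dom A i)) (local_rep i X).

Definition act (X : vf) (f : T -> R^o) : T -> R^o := fun z =>
  let c := chart_at A z in 'D_(X z) (f \o psi A c) (phi A c z).

Definition bracket (X Y : vf) : vf := fun z =>
  let c := chart_at A z in
  'D_(X z) (local_rep c Y) (phi A c z) - 'D_(Y z) (local_rep c X) (phi A c z).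

Definition fscale (f : T -> R^o) (X : vf) : vf := fun z => f z *: X z.

(* The vector field around z extending a with constant components in the
   preferred chart at z; used to evaluate a tensor, given as an operator on
   vector fields, on tangent vectors at z. *)
Definition ext (z : T) (a : 'rV[R]_m) : vf :=
  fun w => tcoord (chart_at A z) (chart_at A w) w a.

(* Exterior derivative of a 1-form. *)
Definition ext_deriv (theta : vf -> T -> R^o) (X Y : vf) : T -> R^o :=
  fun z => act X (theta Y) z - act Y (theta X) z - theta (bracket X Y) z.

Definition lie2 (X : vf) (B : vf -> vf -> T -> R^o) (Y Z : vf) : T -> R^o :=
  fun z => act X (B Y Z) z - B (bracket X Y) Z z - B Y (bracket X Z) z.

(* Froelicher-Nijenhuis brackets: of a vector 1-form with a vector field, and
   of two vector 1-forms. *)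
Definition fn_bracket_vf (L : vf -> vf) (S : vf) (X : vf) : vf :=
  bracket (L X) S \- L (bracket X S).

Definition fn_bracket (K L : vf -> vf) (X Y : vf) : vf := fun z =>
  bracket (K X) (L Y) z + bracket (L X) (K Y) z
  + K (L (bracket X Y)) z + L (K (bracket X Y)) z
  - K (bracket X (L Y)) z - K (bracket (L X) Y) z
  - L (bracket X (K Y)) z - L (bracket (K X) Y) z.

(* Tensors and connections are operators on vector fields defined on the open
   subsets W of a fixed subset O. *)
Definition tensor1 (O : set T) (L : vf -> vf) : Prop :=
  forall W, open_in W -> W `<=` O ->
  forall X Y f, smooth_vf W X -> smooth_vf W Y -> smooth_fun W f ->
  [/\ smooth_vf W (L X),
      forall z, W z -> L (X \+ Y) z = L X z + L Y z
    & forall z, W z -> L (fscale f X) z = f z *: L X z].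

Definition sym_tensor2 (O : set T) (B : vf -> vf -> vf) : Prop :=
  forall W, open_in W -> W `<=` O ->
  forall X Y Z f, smooth_vf W X -> smooth_vf W Y -> smooth_vf W Z ->
    smooth_fun W f ->
  [/\ smooth_vf W (B X Y),
      forall z, W z -> B (X \+ Y) Z z = B X Z z + B Y Z z,
      forall z, W z -> B (fscale f X) Y z = f z *: B X Y z
    & forall z, W z -> B X Y z = B Y X z].

Definition linear_connection (O : set T) (D : vf -> vf -> vf) : Prop :=
  forall W, open_in W -> W `<=` O ->
  forall X Y Z f, smooth_vf W X -> smooth_vf W Y -> smooth_vf W Z ->
    smooth_fun W f ->
  smooth_vf W (D X Y) /\
  forall z, W z ->
  [/\ D (X \+ Y) Z z = D X Z z + D Y Z z,
      D (fscale f X) Y z = f z *: D X Y z,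
      D X (Y \+ Z) z = D X Y z + D X Z z
    & D X (fscale f Y) z = act X f z *: Y z + f z *: D X Y z].

Definition parallel1 (O : set T) (D : vf -> vf -> vf) (L : vf -> vf) : Prop :=
  forall W, open_in W -> W `<=` O ->
  forall X Y, smooth_vf W X -> smooth_vf W Y ->
  forall z, W z -> D X (L Y) z = L (D X Y) z.

Definition curvature (D : vf -> vf -> vf) (X Y Z : vf) : vf :=
  D X (D Y Z) \- D Y (D X Z) \- D (bracket X Y) Z.

Definition cov_deriv (D : vf -> vf -> vf) (Q : vf -> vf -> vf -> vf)
    (V X Y Z : vf) : vf :=
  D V (Q X Y Z) \- Q (D V X) Y Z \- Q X (D V Y) Z \- Q X Y (D V Z).

Definition has_dim (N : set 'rV[R]_m) (k : nat) : Prop :=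
  exists B : 'M[R]_(k, m), row_free B /\ forall a, N a <-> (a <= B)%MS.

(* X is a smooth section over U of the distribution N. *)
Definition section_on (N : T -> set 'rV[R]_m) (U : set T) (X : vf) : Prop :=
  smooth_vf U X /\ forall z, U z -> N z (X z).

Definition completely_integrable (N : T -> set 'rV[R]_m) (U : set T) : Prop :=
  forall X Y, section_on N U X -> section_on N U Y ->
    section_on N U (bracket X Y).

End Calculus.
Arguments vf {R m} T.
Arguments tcoord {R m T} A i j z v.

(* A point of TM: a base point with the components of a tangent vector in the
   preferred chart at that point. *)
Record tvec (R : realType) (n : nat) (M : Type) :=
  TVec { base : M; vec : 'rV[R]_n }.

(* The coordinates (x, y) of TM induced by the charts of M. *)
Definition tatlas (R : realType) (n : nat) (M : Type) (A : atlas R n M) :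
    atlas R (n + n) (tvec R n M) :=
  {| idx := idx A;
     chart_at := fun z => chart_at A (base z);
     dom := fun i z => dom A i (base z);
     phi := fun i z => row_mx (phi A i (base z))
       (tcoord A (chart_at A (base z)) i (base z) (vec z));
     psi := fun i q => let x := psi A i (lsubmx q) in
       TVec x (tcoord A i (chart_at A x) x (rsubmx q)) |}.

Definition slit (R : realType) (n : nat) (M : Type) : set (tvec R n M) :=
  [set z | vec z != 0].
Arguments slit {R n M}.

Section Finsler.
Context {R : realType} {n : nat} {M : Type} (A : atlas R n M).
Let TM := tvec R n M.
Let TA := tatlas A.
Let field := @vf R (n + n) TM.

(* J d/dx^i = d/dy^i, J d/dy^i = 0 *)
Definition Jt (X : field) : field := fun z => row_mx 0 (lsubmx (X z)).

(* y^i d/dy^i *)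
Definition liouville : field := fun z => row_mx 0 (vec z).

Variable E : TM -> R^o.

Definition d_J (X : field) : TM -> R^o := act TA (Jt X) E.

Definition Omega (X Y : field) : TM -> R^o := ext_deriv TA d_J X Y.

Definition Omega_mx (z : TM) : 'M[R]_(n + n) :=
  \matrix_(i, j) Omega (ext TA z (delta_mx 0 i)) (ext TA z (delta_mx 0 j)) z.

Record finsler : Prop := Finsler {
  _ : forall z, slit z -> 0 < E z;
  _ : forall x, E (TVec x 0) = 0;
  _ : smooth_fun TA slit E;
  _ : Ck_fun TA 1 setT E;
  _ : forall z, act TA liouville E z = 2 * E z;
  _ : forall z, slit z -> \rank (Omega_mx z) = (n + n)%N }.

Definition canonical_spray (S : field) : Prop :=
  smooth_vf TA slit S /\
  forall W, open_in TA W -> W `<=` slit ->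
  forall X, smooth_vf TA W X ->
  forall z, W z -> Omega S X z = - act TA X E z.

Variable S : field.

Definition barthel : field -> field := fn_bracket_vf TA Jt S.

Definition hproj (X : field) : field := fun z => 2^-1 *: (X z + barthel X z).

Definition vproj (X : field) : field := fun z => 2^-1 *: (X z - barthel X z).

Definition horizontal (z : TM) : set 'rV[R]_(n + n) :=
  [set a | exists b, a = hproj (ext TA z b) z].

Definition barthel_curvature (X Y : field) : field := fun z =>
  - 2^-1 *: fn_bracket TA hproj hproj X Y z.

Definition almost_complex (F : field -> field) : Prop :=
  tensor1 TA slit F /\
  forall W, open_in TA W -> W `<=` slit ->
  forall X, smooth_vf TA W X ->
  forall z, W z -> F (Jt X) z = hproj X z /\ F (hproj X) z = - Jt X z.

Variable F : field -> field.

Definition metric (X Y : field) : TM -> R^o := Omega X (F Y).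

Definition metric_J (X Y : field) : TM -> R^o := metric (Jt X) (Jt Y).

(* Both arguments are covered by the second condition, by symmetry. *)
Definition sym_semibasic (B : field -> field -> field) : Prop :=
  sym_tensor2 TA slit B /\
  forall W, open_in TA W -> W `<=` slit ->
  forall X Y, smooth_vf TA W X -> smooth_vf TA W Y ->
  forall z, W z -> B (Jt X) Y z = 0 /\ Jt (B X Y) z = 0.

Definition first_cartan (C1 : field -> field -> field) : Prop :=
  sym_semibasic C1 /\
  forall W, open_in TA W -> W `<=` slit ->
  forall X Y Z, smooth_vf TA W X -> smooth_vf TA W Y -> smooth_vf TA W Z ->
  forall z, W z ->
    Omega (C1 X Y) Z z = 2^-1 * lie2 TA (Jt X) metric_J Y Z z.

Definition second_cartan (C2 : field -> field -> field) : Prop :=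
  sym_semibasic C2 /\
  forall W, open_in TA W -> W `<=` slit ->
  forall X Y Z, smooth_vf TA W X -> smooth_vf TA W Y -> smooth_vf TA W Z ->
  forall z, W z ->
    Omega (C2 X Y) Z z = 2^-1 * lie2 TA (hproj X) metric (Jt Y) (Jt Z) z.

Definition berwald (D0 : field -> field -> field) : Prop :=
  [/\ linear_connection TA slit D0,
      parallel1 TA slit D0 F
    & forall W, open_in TA W -> W `<=` slit ->
      forall X Y, smooth_vf TA W X -> smooth_vf TA W Y ->
      forall z, W z ->
        D0 (Jt X) (Jt Y) z = Jt (bracket TA (Jt X) Y) z /\
        D0 (hproj X) (Jt Y) z = vproj (bracket TA (hproj X) (Jt Y)) z].

Definition cartan (D0 C1 C2 D : field -> field -> field) : Prop :=
  [/\ linear_connection TA slit D,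
      parallel1 TA slit D F
    & forall W, open_in TA W -> W `<=` slit ->
      forall X Y, smooth_vf TA W X -> smooth_vf TA W Y ->
      forall z, W z ->
        D (Jt X) (Jt Y) z = D0 (Jt X) (Jt Y) z + C1 X Y z /\
        D (hproj X) (Jt Y) z = D0 (hproj X) (Jt Y) z + C2 X Y z].

Variable D : field -> field -> field.

Definition h_curvature (X Y Z : field) : field :=
  curvature TA D (hproj X) (hproj Y) (Jt Z).

Definition hv_curvature (X Y Z : field) : field :=
  curvature TA D (hproj X) (Jt Y) (Jt Z).

Definition nullity_P (z : TM) : set 'rV[R]_(n + n) :=
  [set a | horizontal z a /\ forall b c : 'rV[R]_(n + n),
    hv_curvature (ext TA z a) (ext TA z b) (ext TA z c) z = 0].

Definition nullity_index_P (z : TM) (k : nat) : Prop :=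
  has_dim (nullity_P z) k.

End Finsler.

(* Main.v *)
From HB Require Import structures.
Require Import Defs.
From mathcomp Require Import all_boot all_order all_algebra.
From mathcomp Require Import all_classical all_reals all_analysis.
From mathcomp Require Import ring lra.
Import Order.TTheory GRing.Theory Num.Theory.
Import numFieldNormedType.Exports.

(** Let X and Y be sections of the nullity distribution of P, let K be the
    curvature of the Cartan connection D, and C the first Cartan tensor.

    Since X and Y are horizontal, their Barthel curvature is -v[X,Y]
    (barthel_curvature_horizontal), so it vanishes exactly when [X,Y] is
    horizontal. For the rest of the nullity condition on [X,Y] use the second
    Bianchi identity in the form in which it follows from the Jacobi identity
    alone (bianchi2),

      sum over cyclic X, Y, JZ of  [D_X, K(Y,JZ)] + K(X,[Y,JZ]) = 0,

    and apply it to JW. The operators K(Y,JZ) and K(JZ,X) kill vertical vectors,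
    because X and Y are null, and D_X and D_Y preserve vertical vectors; in
    [Y,JZ] and [JZ,X] only the horizontal parts count. These parts are known
    from h D_JZ X = h[JZ,X] + FC(X,Z) (h_D_vertical), which brings in the
    covariant derivative of R and the Cartan tensor. The outcome is

      (D_JZ R)(X,Y)W - R(Y,FC(X,Z))W + R(X,FC(Y,Z))W = K([X,Y],JZ)JW

    (mixed_bianchi). Once [X,Y] is horizontal the right-hand side is
    P([X,Y],Z)W, so the condition on R says that P([X,Y],Z) = 0, and both
    implications follow.

    The nullity space at a point is defined by vectors, whereas the identities
    are about fields. Tensoriality (tensorial_eq) passes from fields to vectors.
    In the other direction a vector is extended to a smooth field on all of TM
    with the help of a bump function of the base (global_extension), since the
    condition on R quantifies over globally defined Z.

    The laws of the Lie bracket, on TM as on any manifold, are obtained by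
    letting vector fields act on functions: a field is determined by its action
    on the coordinates of a chart (act_coordf), and the bracket acts as a
    commutator (act_bracket) because second derivatives are symmetric
    (derive_comm). *)

Set Implicit Arguments.
Unset Strict Implicit.
Unset Printing Implicit Defensive.
Local Open Scope classical_set_scope.
Local Open Scope ring_scope.

(** * Functions of class C^k *)

Section Germs.
Context {R : realType} {V W : normedModType R}.
Implicit Types f g : V -> W.

(** Differentiability only depends on the germ: the difference of the two
    functions vanishes near the point, so it has differential zero. *)
Lemma near_eq_differentiable f g p :
  (\near p, f p = g p) -> differentiable f p -> differentiable g p.
Proof.
move=> fg df.
have gE : g = f + (g - f) by rewrite addrC subrK.
rewrite gE; apply: differentiableD => //.
have h0 : (g - f) \o shift p = cst ((g - f) p) + (\0 : V -> W) +o_ 0 id.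
  apply/eqaddoP => _/posnumP[e].
  have fgp := nbhs_singleton fg.
  move: fg; rewrite (near_shift 0 p) subr0 => fg; near=> h.
  rewrite /= !fctE /= fgp subrr addr0 subr0.
  have -> : f (h + p) = g (h + p) by near: h; exact: fg.
  by rewrite subrr normr0 mulr_ge0.
have c0 : continuous (\0 : V -> W) by move=> x; exact: cvg_cst.
by apply/diff_locallyP; rewrite (diff_unique c0 h0).
Unshelve. all: by end_near. Qed.

(** Linearity in the direction holds for differentiable functions only; a merely
    derivable function need not satisfy it. *)
Lemma derive_sumZ m f p (a : 'I_m -> R) (v : 'I_m -> V) :
  differentiable f p ->
  'D_(\sum_i a i *: v i) f p = \sum_i a i *: 'D_(v i) f p.
Proof.
move=> df; rewrite deriveE // linear_sum.
by apply: eq_bigr => i _; rewrite linearZ deriveE.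
Qed.

Lemma derive_addv f p (u v : V) :
  differentiable f p -> 'D_(u + v) f p = 'D_u f p + 'D_v f p.
Proof. by move=> df; rewrite !deriveE // linearD. Qed.

Lemma derive_scalev f p (a : R) (v : V) :
  differentiable f p -> 'D_(a *: v) f p = a *: 'D_v f p.
Proof. by move=> df; rewrite !deriveE // linearZ. Qed.

End Germs.

Lemma derive_compE {R : realType} {U V W : normedModType R} (f : U -> V)
    (g : V -> W) p v :
  differentiable f p -> differentiable g (f p) ->
  'D_v (g \o f) p = 'D_('D_v f p) g (f p).
Proof.
move=> df dg; rewrite deriveE; last exact: differentiable_comp.
by rewrite diff_comp //= !deriveE.
Qed.

Section CkTheory.
Context {R : realType}.

Lemma Ck_sub (V W : normedModType R) k (O O' : set V) (f : V -> W) :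
  O' `<=` O -> Ck k O f -> Ck k O' f.
Proof.
move=> OO'; elim: k f => [|k IH] f /=.
  by move=> cf x /set_mem /OO' /mem_set; exact: cf.
by move=> [df Df]; split => [p /OO' /df //|v]; exact: IH.
Qed.

(** C^k is a condition at each point, so it can be checked on a cover, even by
    sets that are not open. *)
Lemma Ck_local (V W : normedModType R) k (O : set V) (f : V -> W) :
  (forall p, O p -> exists2 O', O' p & Ck k O' f) -> Ck k O f.
Proof.
elim: k f => [|k IH] f /= H.
  move=> x /set_mem /H [N Nx cf]; apply: cf; exact: mem_set.
split=> [p /H [N Np [+ _]]|v]; first exact.
by apply: IH => p /H [N Np [_ +]]; exists N.
Qed.

(** Openness lets the equality be differentiated: the directional derivatives of
    f and g agree on the same set, and the induction goes on. *)
Lemma Ck_eq (V W : normedModType R) k (O : set V) (f g : V -> W) :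
  open O -> (forall p, O p -> f p = g p) -> Ck k O f -> Ck k O g.
Proof.
move=> oO; elim: k f g => [|k IH] f g fg /=.
  move=> cf x xO; have Ox := set_mem xO.
  rewrite /continuous_at -(fg _ Ox); apply: cvg_trans (cf x xO).
  by apply: near_eq_cvg; near=> y; apply: fg; near: y; exact: open_nbhs_nbhs.
move=> [df Df]; have nfg p : O p -> \near p, f p = g p.
  by move=> Op; near=> y; apply: fg; near: y; exact: open_nbhs_nbhs.
split=> [p Op|v].
  exact: near_eq_differentiable (nfg _ Op) (df _ Op).
by apply: IH (Df v) => p Op; apply: near_eq_derive; exact: nfg.
Unshelve. all: by end_near. Qed.

Lemma CkW (V W : normedModType R) k (O : set V) (f : V -> W) :
  Ck k.+1 O f -> Ck k O f.
Proof.
elim: k f => [|k IH] f /= [df Df].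
  by move=> x /set_mem Ox; exact: differentiable_continuous (df _ Ox).
by split=> // v; apply: IH; exact: Df.
Qed.

Lemma Ck_cst (V W : normedModType R) k (O : set V) (c : W) :
  Ck k O (fun _ : V => c).
Proof.
elim: k c => [|k IH] c /=; first by move=> x _; exact: cvg_cst.
split=> [p _|v]; first exact: differentiable_cst.
rewrite (_ : 'D_v _ = fun _ => 0) //.
by apply/funext => p; exact: derive_cst.
Qed.

Lemma Ck_add (V W : normedModType R) k (O : set V) (f g : V -> W) :
  open O -> Ck k O f -> Ck k O g -> Ck k O (fun p => f p + g p).
Proof.
move=> oO; elim: k f g => [|k IH] f g /=.
  by move=> cf cg x xO; apply: cvgD; [exact: cf|exact: cg].
move=> [df Df][dg Dg]; split=> [p Op|v].
  by apply: differentiableD; [exact: df|exact: dg].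
apply: Ck_eq (IH _ _ (Df v) (Dg v)) => // p Op.
by rewrite -[in RHS]/(f + g) deriveD //; apply: diff_derivable; [exact: df|exact: dg].
Qed.

Lemma Ck_sum (V W : normedModType R) k (O : set V) (I : finType)
    (f : I -> V -> W) :
  open O -> (forall i, Ck k O (f i)) -> Ck k O (fun p => \sum_i f i p).
Proof.
move=> oO Hf; rewrite (_ : (fun p => _) = \sum_i f i); last first.
  by apply/funext => p; rewrite fct_sumE.
elim/big_rec: _ => [|i g _ Hg]; first exact: Ck_cst.
exact: Ck_add.
Qed.

Lemma Ck_mul (V : normedModType R) k (O : set V) (f g : V -> R^o) :
  open O -> Ck k O f -> Ck k O g -> Ck k O (fun p => f p * g p : R^o).
Proof.
move=> oO; elim: k f g => [|k IH] f g.
  by move=> cf cg x xO; apply: cvgM; [exact: cf|exact: cg].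
move=> Cf Cg; have [df Df] := Cf; have [dg Dg] := Cg; split=> [p Op|v].
  by apply: differentiableM; [exact: df|exact: dg].
apply: Ck_eq (Ck_add oO (IH _ _ (CkW Cf) (Dg v)) (IH _ _ (CkW Cg) (Df v))) => //.
move=> p Op.
by rewrite -[in RHS]/(f * g) deriveM //; apply: diff_derivable; [exact: df|exact: dg].
Qed.

Lemma Ck_opp (V : normedModType R) k (O : set V) (f : V -> R^o) :
  open O -> Ck k O f -> Ck k O (fun p => - f p).
Proof.
move=> oO Cf; apply: Ck_eq (Ck_mul oO (Ck_cst k O (-1 : R^o)) Cf) => // p _.
by rewrite mulN1r.
Qed.

Lemma Ck_lin (V W W' : normedModType R) k (O : set V) (f : V -> W)
    (L : {linear W -> W'}) :
  open O -> continuous L -> Ck k O f -> Ck k O (L \o f).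
Proof.
move=> oO cL; elim: k f => [|k IH] f /=.
  by move=> cf x xO; apply: continuous_comp; [exact: cf|exact: cL].
move=> [df Df]; split=> [p Op|v].
  by apply: differentiable_comp (df p Op) _; exact: linear_differentiable.
apply: Ck_eq (IH _ (Df v)) => // p Op /=.
rewrite derive_compE; [|exact: df|exact: linear_differentiable].
rewrite [RHS]deriveE; last exact: linear_differentiable.
by rewrite diff_lin.
Qed.

Lemma Ck_linear (V W : normedModType R) k (O : set V) (L : {linear V -> W}) :
  continuous L -> Ck k O L.
Proof.
move=> cL; case: k => [|k] /=; first by move=> x _; exact: cL.
split=> [p _|v]; first exact: linear_differentiable.
rewrite (_ : 'D_v _ = fun _ => L v); first exact: Ck_cst.
apply/funext => p; rewrite deriveE; last exact: linear_differentiable.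
by rewrite diff_lin.
Qed.

Lemma Ck_id (V : normedModType R) k (O : set V) : Ck k O (@id V).
Proof. by apply: (@Ck_linear _ _ _ _ idfun) => x; exact: cvg_id. Qed.

Definition coordL m n i j : 'M[R]_(m, n) -> R^o := fun N => N i j.

Lemma coordL_linear m n i j : linear (@coordL m n i j).
Proof. by move=> a x y; rewrite /coordL !mxE. Qed.

HB.instance Definition _ m n i j :=
  GRing.isLinear.Build R 'M[R]_(m, n) R^o _ (@coordL m n i j)
   (@coordL_linear m n i j).

Lemma Ck_coord (V : normedModType R) k (O : set V) m (f : V -> 'rV[R]_m) i :
  open O -> Ck k O f -> Ck k O (fun p => f p 0 i : R^o).
Proof.
by move=> oO; apply: (@Ck_lin _ _ _ _ _ _ (@coordL 1 m 0 i)) => //; exact: coord_continuous.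
Qed.

Lemma Ck_scalel (V W : normedModType R) k (O : set V) (f : V -> R^o) (w : W) :
  open O -> Ck k O f -> Ck k O (fun p => f p *: w).
Proof.
move=> oO; elim: k f => [|k IH] f /=.
  by move=> cf x xO; apply: cvgZr_tmp; exact: cf.
move=> [df Df]; split=> [p Op|v].
  by apply: differentiableZl; exact: df.
apply: Ck_eq (IH _ (Df v)) => // p Op /=.
rewrite [RHS]deriveE; last exact: differentiableZl (df _ Op).
by rewrite diffZl ?deriveE//; exact: df.
Qed.

(** Vector valued functions are treated through their entries, so that the
    product and chain rules are only needed for scalar functions. *)
Lemma Ck_row (V : normedModType R) k (O : set V) m (f : V -> 'rV[R]_m) :
  open O -> (forall i, Ck k O (fun p => f p 0 i : R^o)) -> Ck k O f.
Proof.
move=> oO Hf; have := Ck_sum oO (fun i => Ck_scalel (delta_mx 0 i : 'rV[R]_m) oO (Hf i)).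
by congr Ck; apply/funext => p; rewrite [RHS]row_sum_delta.
Qed.

Lemma derive_rowE m (W : normedModType R) (g : 'rV[R]_m -> W) q v :
  differentiable g q ->
  'D_v g q = \sum_i v 0 i *: 'D_(delta_mx 0 i) g q.
Proof. by move=> dg; rewrite {1}[v]row_sum_delta derive_sumZ. Qed.

Lemma derive_coord (V : normedModType R) m (f : V -> 'rV[R]_m) p v i :
  differentiable f p ->
  ('D_v f p) 0 i = 'D_v (fun q => f q 0 i : R^o) p.
Proof.
move=> df; rewrite derive_mx ?mxE //; exact: diff_derivable.
Qed.

(** In coordinates the chain rule reads
      D_v (g o f) = sum_i (D_v f)_i * (D_i g o f),
    which has one derivative less and is again made of sums, products and
    composites. *)
Lemma Ck_comp (V : normedModType R) k (O : set V) m (O' : set 'rV[R]_m)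
   (f : V -> 'rV[R]_m) (g : 'rV[R]_m -> R^o) :
  open O -> (forall p, O p -> O' (f p)) ->
  Ck k O f -> Ck k O' g -> Ck k O (g \o f).
Proof.
move=> oO fO; elim: k g => [|k IH] g.
  move=> cf cg x xO; apply: continuous_comp; first exact: cf.
  by apply: cg; apply: mem_set; apply: fO; exact: set_mem.
move=> Cf Cg; have [df Df] := Cf; have [dg Dg] := Cg; split=> [p Op|v].
  by apply: differentiable_comp; [exact: df|exact/dg/fO].
have := Ck_sum oO (fun i => Ck_mul oO (Ck_coord i oO (Df v))
   (IH _ (CkW Cf) (Dg (delta_mx 0 i)))).
apply: Ck_eq => // p Op /=; have dfp := df _ Op; have dgp := dg _ (fO _ Op).
by rewrite [RHS]derive_compE // [RHS]derive_rowE.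
Qed.

Lemma Ck_derive_along k m (O : set 'rV[R]_m)
    (X : 'rV[R]_m -> 'rV[R]_m) (f : 'rV[R]_m -> R^o) :
  open O -> Ck k O X -> Ck k.+1 O f -> Ck k O (fun q => 'D_(X q) f q).
Proof.
move=> oO CX [df Df].
have := Ck_sum oO (fun i => Ck_mul oO (Ck_coord i oO CX) (Df (delta_mx 0 i))).
apply: Ck_eq => // p Op; rewrite derive_rowE //; exact: df.
Qed.

End CkTheory.

(** * Symmetry of second derivatives *)

Lemma not_within_half {R : realType} (x y z : R) :
  `|x - z| < `|x - y| / 2 -> `|y - z| < `|x - y| / 2 -> False.
Proof.
move=> xz yz; have : `|x - y| <= `|x - z| + `|y - z|.
  by rewrite (distrC y z); exact: ler_distD.
lra.
Qed.

Section Schwarz.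
Context {R : realType} {V : normedModType R}.
Implicit Types (f : V -> R^o) (p q u v : V) (O : set V).

Lemma is_derive_line f p u (t : R) :
  differentiable f (p + t *: u) ->
  is_derive (t : R) (1 : R) (fun s : R => f (p + s *: u) : R)
    ('D_u f (p + t *: u) : R).
Proof.
move=> df; pose l : R -> V := cst p + ( *:%R^~ u).
have dl : is_diff t l (cst 0 + ( *:%R^~ u)) by exact: is_diffD.
have dlt : differentiable l t by [].
have dfl : differentiable (f \o l) t by exact: differentiable_comp.
have Dl : 'D_1 l t = u by rewrite deriveE // diff_val /cst !fctE add0r scale1r.
have Dfl : 'D_1 (f \o l) t = 'D_u f (p + t *: u).
  by rewrite (derive_compE (1 : R^o) dlt df) Dl.
exact: (DeriveDef (diff_derivable dfl) Dfl).
Qed.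

Lemma mean_value_line f p u (s : R) : 0 < s ->
  (forall t, 0 <= t <= s -> differentiable f (p + t *: u)) ->
  exists2 t, 0 <= t <= s & f (p + s *: u) - f p = 'D_u f (p + t *: u) * s.
Proof.
move=> s0 df.
pose g : R -> R := fun t => f (p + t *: u).
pose dg : R -> R := fun t => 'D_u f (p + t *: u).
have dg' t : t \in `[0, s] -> is_derive t (1 : R) g (dg t).
  by rewrite in_itv /= => ht; exact: (is_derive_line (df t ht)).
have dgo t : t \in `]0, s[ -> is_derive t (1 : R) g (dg t).
  by rewrite in_itv /= => /andP[t0 ts]; apply: dg'; rewrite in_itv /= !ltW.
have cg : {within `[0, s], continuous g}.
  by apply: derivable_within_continuous => t /dg' [].
have [t] := MVT_segment (ltW s0) dgo cg.
rewrite in_itv /= => ht; rewrite /g /dg scale0r addr0 subr0 => E.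
by exists t.
Qed.

(** The mean value theorem along u, then along v. The left-hand side is
    symmetric in u and v while the right-hand side is not, and this is why mixed
    derivatives commute. *)
Lemma second_difference f p u v (s : R) : 0 < s ->
  (forall a b, 0 <= a <= s -> 0 <= b <= s ->
     differentiable f (p + a *: u + b *: v) /\
     differentiable ('D_u f) (p + a *: u + b *: v)) ->
  exists a b, [/\ 0 <= a <= s, 0 <= b <= s &
    f (p + s *: u + s *: v) - f (p + s *: u) - f (p + s *: v) + f p =
    'D_v ('D_u f) (p + a *: u + b *: v) * s * s].
Proof.
move=> s0 df; have s00 : 0 <= (0 : R) <= s by rewrite lexx ltW.
have sss : 0 <= s <= s by rewrite lexx ltW.
pose g : V -> R^o := (fun q => f (q + s *: v)) - f.
have dfs a : 0 <= a <= s ->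
    differentiable (fun q => f (q + s *: v)) (p + a *: u) /\
    'D_u (fun q => f (q + s *: v)) (p + a *: u) = 'D_u f (p + a *: u + s *: v).
  move=> ha; pose l : V -> V := id + cst (s *: v).
  have dl : is_diff (p + a *: u) l (id + cst 0) by exact: is_diffD.
  have dl' : differentiable l (p + a *: u) by [].
  have dfl : differentiable f (l (p + a *: u)) by have [] := df _ _ ha sss.
  rewrite -[fun q => _]/(f \o l); split; first exact: differentiable_comp.
  have Dl : 'D_u l (p + a *: u) = u by rewrite deriveE // diff_val /cst !fctE addr0.
  by rewrite (derive_compE u dl' dfl) Dl.
have df0 a : 0 <= a <= s -> differentiable f (p + a *: u).
  by move=> ha; have [] := df _ _ ha s00; rewrite scale0r addr0.
have [a|a ha] := @mean_value_line g p u s s0.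
  by move=> ha; apply: differentiableB; [case: (dfs _ ha)|exact: df0].
have [dfa Da] := dfs _ ha.
rewrite deriveB; [|exact: diff_derivable|exact/diff_derivable/df0].
rewrite Da => gE.
have [b|b hb ab] := @mean_value_line ('D_u f) (p + a *: u) v s s0.
  by move=> hb; have [] := df _ _ ha hb.
exists a, b; split => //; rewrite -ab -gE /g !fctE /=.
by rewrite opprB addrA addrAC.
Qed.

(** If the two mixed derivatives differed by e at p, continuity would keep each
    of them within e / 2 of its value at p on a small parallelogram; but by
    second_difference each of them takes the same value at some point there. *)
Lemma derive_comm f O p u v : open O -> O p -> Ck 2 O f ->
  'D_v ('D_u f) p = 'D_u ('D_v f) p.
Proof.
move=> oO Op [df Df].
have [dDu cDu] := Df u; have [dDv cDv] := Df v.
have Onp : nbhs p O by exact: open_nbhs_nbhs.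
have half a b (e : R) : 0 < e ->
  \forall q \near p, O q /\ `|'D_a ('D_b f) p - 'D_a ('D_b f) q| < e.
  move=> e0; near=> q; split; first by near: q.
  near: q; have [_ cc] := Df b; have := cc a p (mem_set Op).
  by move/cvgrPdist_lt; apply.
apply/eqP; rewrite -subr_eq0 -normr_eq0; apply/negPn/negP => nz.
have e0 : 0 < `|'D_v ('D_u f) p - 'D_u ('D_v f) p| by rewrite lt_neqAle eq_sym nz /=.
move: e0; set e := `|_| => e0; have e20 : 0 < e / 2 by rewrite divr_gt0.
have /nbhs_ballP[r1 /= r10 B1] := half v u _ e20.
have /nbhs_ballP[r2 /= r20 B2] := half u v _ e20.
(* The 1 keeps c positive when u = v = 0. *)
pose c := `|u| + `|v| + 1; have c0 : 0 < c by rewrite ltr_wpDl // addr_ge0.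
pose r := Num.min r1 r2; have r0 : 0 < r by rewrite lt_min r10 r20.
pose s := r / 2 / c; have s0 : 0 < s by rewrite !divr_gt0.
have near_p a b a' b' : 0 <= a <= s -> 0 <= b <= s ->
    `|a'| + `|b'| <= `|u| + `|v| -> `|p - (p + a *: a' + b *: b')| < r.
  move=> /andP[a0 as_] /andP[b0 bs] ab.
  rewrite -addrA opprD addrA subrr add0r normrN.
  apply: le_lt_trans (ler_normD _ _) _; rewrite !normrZ !ger0_norm //.
  apply: (@le_lt_trans _ _ (s * (`|u| + `|v|))).
    apply: (@le_trans _ _ (s * (`|a'| + `|b'|))); last by rewrite ler_wpM2l // ltW.
    by rewrite mulrDr lerD // ler_wpM2r.
  apply: (@lt_trans _ _ (s * c)); first by rewrite ltr_pM2l // ltrDl.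
  rewrite /s divfK ?gt_eqF //; lra.
have inB a b a' b' : 0 <= a <= s -> 0 <= b <= s ->
    `|a'| + `|b'| <= `|u| + `|v| ->
    ball p r1 (p + a *: a' + b *: b') /\ ball p r2 (p + a *: a' + b *: b').
  move=> ha hb hab; have := near_p _ _ _ _ ha hb hab.
  by rewrite lt_min -ball_normE /= => /andP[].
have vu : `|v| + `|u| <= `|u| + `|v| by rewrite addrC.
have [a [b [ha hb E1]]] : exists a b, [/\ 0 <= a <= s, 0 <= b <= s &
    f (p + s *: u + s *: v) - f (p + s *: u) - f (p + s *: v) + f p =
    'D_v ('D_u f) (p + a *: u + b *: v) * s * s].
  apply: second_difference => // a b ha hb.
  have [/B1[Oab _] _] := inB _ _ _ _ ha hb (lexx _).
  by split; [exact: df|exact: dDu].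
have [a' [b' [ha' hb' E2]]] : exists a b, [/\ 0 <= a <= s, 0 <= b <= s &
    f (p + s *: v + s *: u) - f (p + s *: v) - f (p + s *: u) + f p =
    'D_u ('D_v f) (p + a *: v + b *: u) * s * s].
  apply: second_difference => // a' b' ha' hb'.
  have [/B1[Oab _] _] := inB _ _ _ _ ha' hb' vu.
  by split; [exact: df|exact: dDv].
have [/B1[_ N1] _] := inB _ _ _ _ ha hb (lexx _).
have [_ /B2[_ N2]] := inB _ _ _ _ ha' hb' vu.
have E : 'D_v ('D_u f) (p + a *: u + b *: v) = 'D_u ('D_v f) (p + a' *: v + b' *: u).
  have cancel (x y d : R) : d = x * s * s -> d = y * s * s -> x = y.
    move=> -> xy; have ss : s != 0 by rewrite gt_eqF.
    by apply: (mulIf ss); apply: (mulIf ss).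
  apply: cancel E1 _; rewrite -E2 (addrAC p (s *: v)); congr (_ + _); exact: addrAC.
rewrite E in N1.
exact: not_within_half N1 N2.
Unshelve. all: by end_near. Qed.

End Schwarz.

(** * Vector fields as derivations on a smooth atlas *)

(** Differentiating a derivative along X separates the variation of X from the
    second derivative of f along the frozen vector X p; symmetry applies to the
    latter. *)
Lemma derive_along_derive {R : realType} m (O : set 'rV[R]_m)
    (X : 'rV[R]_m -> 'rV[R]_m) (f : 'rV[R]_m -> R^o) p a :
  open O -> O p -> differentiable X p -> Ck 2 O f ->
  'D_a (fun q => 'D_(X q) f q) p = 'D_('D_a X p) f p + 'D_a ('D_(X p) f) p.
Proof.
move=> oO Op dX [df Df].
have dDf i : differentiable ('D_(delta_mx 0 i) f : 'rV[R]_m -> R^o) p.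
  by have [+ _] := Df (delta_mx 0 i); apply.
have dXi i : differentiable (fun q => X q 0 i : R^o) p.
  exact: differentiable_comp dX (differentiable_coord _ _ _).
have npO : \near p, O p by exact: open_nbhs_nbhs.
pose h i q : R^o := X q 0 i * 'D_(delta_mx 0 i) f q.
pose h' i q : R^o := X p 0 i *: 'D_(delta_mx 0 i) f q.
have -> : 'D_a (fun q => 'D_(X q) f q) p = 'D_a (\sum_i h i) p.
  apply: near_eq_derive; near=> q; rewrite fct_sumE derive_rowE //.
  by apply: df; near: q.
have -> : 'D_a ('D_(X p) f) p = 'D_a (\sum_i h' i) p.
  apply: near_eq_derive; near=> q; rewrite fct_sumE derive_rowE //.
  by apply: df; near: q.
rewrite !derive_sum; last 2 first.
- move=> i; apply: derivableZ; exact: diff_derivable.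
- by move=> i; apply: derivableM; exact: diff_derivable.
rewrite [in RHS]derive_rowE; last exact: df.
rewrite -big_split; apply: eq_bigr => i _ /=.
rewrite deriveM; [|exact: diff_derivable..].
rewrite deriveZ; last exact: diff_derivable.
by rewrite derive_coord // addrC; congr (_ + _); exact: mulrC.
Unshelve. all: by end_near. Qed.

(** The part of a smooth manifold on which the calculus of vector fields rests.
    It does not refer to a topology on T, so that it also fits the tangent
    bundle, whose points carry none. *)
Record smooth_atlas (R : realType) (m : nat) (T : Type) (A : atlas R m T) :
    Prop := SmoothAtlas {
  chart_atP : forall z, dom A (chart_at A z) z;
  psiK : forall i z, dom A i z -> psi A i (phi A i z) = z;
  overlap_open : forall i j, open (phi A i @` (dom A i `&` dom A j));
  transition_Ck : forall i j k,
    Ck k (phi A i @` (dom A i `&` dom A j)) (phi A j \o psi A i) }.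

Section AtlasCalculus.
Context {R : realType} {m : nat} {T : Type} (A : atlas R m T).
Hypothesis sA : smooth_atlas A.
Implicit Types (W : set T) (X Y Z : @vf R m T) (f g : T -> R^o).

Local Notation img i W := (phi A i @` (W `&` dom A i)).
Local Notation cz z := (chart_at A z).

Lemma imgP i W q : img i W q ->
  [/\ W (psi A i q), dom A i (psi A i q) & phi A i (psi A i q) = q].
Proof. by case=> z [Wz iz] <-; rewrite psiK. Qed.

Lemma mem_img i W z : W z -> dom A i z -> img i W (phi A i z).
Proof. by move=> Wz iz; exists z. Qed.

Lemma imgI i W W' : img i (W `&` W') = img i W `&` img i W'.
Proof.
apply/seteqP; split=> q.
  by case=> z [[Wz W'z] iz] <-; split; exists z.
by case=> /imgP[Wq iq qE] /imgP[W'q _ _]; exists (psi A i q).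
Qed.

Lemma open_in_setI W W' : open_in A W -> open_in A W' -> open_in A (W `&` W').
Proof. by move=> oW oW' i; rewrite imgI; exact: openI. Qed.

Lemma open_in_dom c : open_in A (dom A c).
Proof. by move=> i; rewrite setIC; exact: overlap_open. Qed.
Arguments open_in_dom : clear implicits.

Lemma near_img i W z : open_in A W -> W z -> dom A i z ->
  \forall q \near phi A i z, img i W q.
Proof. by move=> oW Wz iz; apply: open_nbhs_nbhs; split; [exact: oW|exact: mem_img]. Qed.

Lemma transition_diff i j z : dom A i z -> dom A j z ->
  differentiable (phi A j \o psi A i) (phi A i z).
Proof.
move=> iz jz; have [+ _] := transition_Ck sA i j 1.
by apply; exists z.
Qed.

Lemma near_chart (V : Type) (f : T -> V) i j z : dom A i z -> dom A j z ->
  \forall q \near phi A i z,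
     (f \o psi A j \o (phi A j \o psi A i)) q = (f \o psi A i) q.
Proof.
move=> iz jz; have := near_img (open_in_dom j) jz iz.
apply: filterS => q /imgP[jq iq _] /=; by rewrite psiK.
Qed.

(** The chain rule through the transition map: all chart independence below
    comes from this. *)
Lemma chart_change_derive (V : normedModType R) (f : T -> V) i j z v :
  dom A i z -> dom A j z ->
  differentiable (f \o psi A j) (phi A j z) ->
  'D_v (f \o psi A i) (phi A i z) =
  'D_(tcoord A i j z v) (f \o psi A j) (phi A j z).
Proof.
move=> iz jz df; rewrite -(near_eq_derive _ (near_chart f iz jz)).
have tj : (phi A j \o psi A i) (phi A i z) = phi A j z by rewrite /= psiK.
rewrite derive_compE; last by rewrite tj.
  by rewrite tj.
exact: transition_diff.
Qed.

Lemma tcoord_id i z v : dom A i z -> tcoord A i i z v = v.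
Proof.
move=> iz; rewrite /tcoord -[RHS](derive_id (phi A i z) v).
apply: near_eq_derive; have := near_img (open_in_dom i) iz iz.
by apply: filterS => q /imgP[].
Qed.

Lemma tcoord_comp i j k z v : dom A i z -> dom A j z -> dom A k z ->
  tcoord A j k z (tcoord A i j z v) = tcoord A i k z v.
Proof.
move=> iz jz kz; rewrite [RHS]/tcoord (chart_change_derive _ iz jz) //.
exact: transition_diff.
Qed.

Lemma tcoordZ i j z a v : dom A i z -> dom A j z ->
  tcoord A i j z (a *: v) = a *: tcoord A i j z v.
Proof. by move=> iz jz; apply: derive_scalev; exact: transition_diff. Qed.

Lemma local_repE i X z : dom A i z ->
  local_rep i X (phi A i z) = tcoord A (cz z) i z (X z).
Proof. by move=> iz; rewrite /local_rep psiK. Qed.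

Lemma smooth_fun_diff W f i z : smooth_fun A W f -> W z -> dom A i z ->
  differentiable (f \o psi A i) (phi A i z).
Proof. by move=> sf Wz iz; have [+ _] := sf 1 i; apply; exact: mem_img. Qed.

(** The derivative along X, defined in the preferred chart, may be computed in
    any chart: this is what makes it a smooth function. *)
Lemma act_chart W X f i z : smooth_fun A W f -> W z -> dom A i z ->
  act A X f z = 'D_(local_rep i X (phi A i z)) (f \o psi A i) (phi A i z).
Proof.
move=> sf Wz iz; rewrite /act local_repE //.
by apply: chart_change_derive => //; [exact: chart_atP|exact: smooth_fun_diff sf _ _].
Qed.

Lemma act_diff W f z : smooth_fun A W f -> W z ->
  differentiable (f \o psi A (cz z)) (phi A (cz z) z).
Proof. by move=> sf Wz; apply: smooth_fun_diff sf Wz _; exact: chart_atP. Qed.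

Lemma smooth_fun_sub W W' f : W' `<=` W -> smooth_fun A W f -> smooth_fun A W' f.
Proof.
move=> WW' sf k i; apply: Ck_sub (sf k i) => q [z [W'z iz] <-].
by exists z => //; split => //; exact: WW'.
Qed.

Lemma smooth_vf_sub W W' X : W' `<=` W -> smooth_vf A W X -> smooth_vf A W' X.
Proof.
move=> WW' sX i k; apply: Ck_sub (sX i k) => q [z [W'z iz] <-].
by exists z => //; split => //; exact: WW'.
Qed.

Lemma smooth_fun_eq W f g : open_in A W -> (forall z, W z -> f z = g z) ->
  smooth_fun A W f -> smooth_fun A W g.
Proof.
move=> oW fg sf k i; apply: (Ck_eq (oW i) _ (sf k i)) => q /imgP[Wq _ _].
exact: fg.
Qed.

Lemma smooth_vf_eq W X Y : open_in A W -> (forall z, W z -> X z = Y z) ->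
  smooth_vf A W X -> smooth_vf A W Y.
Proof.
move=> oW XY sX i k; apply: (Ck_eq (oW i) _ (sX i k)) => q /imgP[Wq _ _].
by rewrite /local_rep XY.
Qed.

Lemma smooth_fun_cst W (c : R^o) : smooth_fun A W (fun=> c).
Proof. by move=> k i; exact: Ck_cst. Qed.

Lemma smooth_fun_add W f g : open_in A W ->
  smooth_fun A W f -> smooth_fun A W g -> smooth_fun A W (fun z => f z + g z).
Proof.
by move=> oW sf sg k i; exact: (Ck_add (oW i) (sf k i) (sg k i)).
Qed.

Lemma smooth_fun_mul W f g : open_in A W ->
  smooth_fun A W f -> smooth_fun A W g ->
  smooth_fun A W (fun z => f z * g z : R^o).
Proof.
by move=> oW sf sg k i; exact: (Ck_mul (oW i) (sf k i) (sg k i)).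
Qed.

Lemma smooth_fun_opp W f : open_in A W ->
  smooth_fun A W f -> smooth_fun A W (fun z => - f z).
Proof. by move=> oW sf k i; exact: (Ck_opp (oW i) (sf k i)). Qed.

Lemma smooth_fun_subr W f g : open_in A W ->
  smooth_fun A W f -> smooth_fun A W g -> smooth_fun A W (fun z => f z - g z).
Proof. by move=> oW sf sg; apply: smooth_fun_add => //; exact: smooth_fun_opp. Qed.

Lemma smooth_fun_act W X f : open_in A W ->
  smooth_vf A W X -> smooth_fun A W f -> smooth_fun A W (act A X f).
Proof.
move=> oW sX sf k i.
have := Ck_derive_along (oW i) (sX i k) (sf k.+1 i).
apply: (Ck_eq (oW i)) => q /imgP[Wq iq qE].
by rewrite /= (act_chart X sf Wq iq) qE.
Qed.

Definition coordf i k : T -> R^o := fun z => phi A i z 0 k.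

Lemma smooth_coordf i k : smooth_fun A (dom A i) (coordf i k).
Proof.
move=> l j; rewrite setIC.
have H := Ck_coord k (@overlap_open _ _ _ _ sA j i) (transition_Ck sA j i l).
exact: H.
Qed.

(** The components of X in the chart i are the derivatives of the coordinates of
    that chart. Identities between vector fields, and their smoothness, thus
    reduce to statements on derivations of functions. *)
Lemma act_coordf X i k z : dom A i z ->
  act A X (coordf i k) z = local_rep i X (phi A i z) 0 k.
Proof.
move=> iz; rewrite /act local_repE //.
rewrite (chart_change_derive _ (chart_atP sA z) iz); last first.
  exact: (smooth_fun_diff (smooth_coordf i k) iz iz).
set v := tcoord _ _ _ _ _.
have dt : differentiable (phi A i \o psi A i) (phi A i z) by exact: transition_diff.
by rewrite -[v in RHS](tcoord_id _ iz) /tcoord derive_coord.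
Qed.

Lemma vf_eq_act X Y z :
  (forall k, act A X (coordf (cz z) k) z = act A Y (coordf (cz z) k) z) ->
  X z = Y z.
Proof.
have zc := chart_atP sA z => H; apply/rowP => k; have := H k.
by rewrite !(act_coordf _ _ zc) !(local_repE _ zc) !(tcoord_id _ zc).
Qed.

Lemma smooth_vfP W X : open_in A W ->
  (forall i k, smooth_fun A (W `&` dom A i) (act A X (coordf i k))) ->
  smooth_vf A W X.
Proof.
move=> oW H i k; apply: (Ck_row (oW i)) => l; have := H i l k i.
rewrite -setIA setIid; apply: (Ck_eq (oW i)) => q /imgP[Wq iq qE].
by rewrite /= act_coordf ?qE.
Qed.

Lemma smooth_act_coordf W X i k : open_in A W -> smooth_vf A W X ->
  smooth_fun A (W `&` dom A i) (act A X (coordf i k)).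
Proof.
move=> oW sX; apply: smooth_fun_act.
- exact: open_in_setI oW (open_in_dom i).
- by apply: smooth_vf_sub sX => z [].
- by apply: smooth_fun_sub (smooth_coordf i k) => z [].
Qed.

Lemma act_eq W f g X Y z : open_in A W -> W z -> X z = Y z ->
  (forall w, W w -> f w = g w) -> act A X f z = act A Y g z.
Proof.
move=> oW Wz XY fg; rewrite /act XY; apply: near_eq_derive.
have := near_img oW Wz (chart_atP sA z).
by apply: filterS => q /imgP[Wq _ _]; exact: fg.
Qed.

Lemma act_addf W X f g z : smooth_fun A W f -> smooth_fun A W g -> W z ->
  act A X (fun z => f z + g z) z = act A X f z + act A X g z.
Proof.
move=> sf sg Wz; rewrite /act -deriveD //; apply: diff_derivable.
  exact: act_diff sf Wz.
exact: act_diff sg Wz.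
Qed.

Lemma act_subf W X f g z : smooth_fun A W f -> smooth_fun A W g -> W z ->
  act A X (fun z => f z - g z) z = act A X f z - act A X g z.
Proof.
move=> sf sg Wz; rewrite /act -deriveB //; apply: diff_derivable.
  exact: act_diff sf Wz.
exact: act_diff sg Wz.
Qed.

Lemma act_mulf W X f g z : smooth_fun A W f -> smooth_fun A W g -> W z ->
  act A X (fun z => f z * g z : R^o) z =
  f z * act A X g z + g z * act A X f z.
Proof.
move=> sf sg Wz; have zc := chart_atP sA z; have vK : psi A (cz z) (phi A (cz z) z) = z by rewrite psiK.
have df : derivable (f \o psi A (cz z)) (phi A (cz z) z) (X z).
  exact/diff_derivable/(act_diff sf Wz).
have dg : derivable (g \o psi A (cz z)) (phi A (cz z) z) (X z).
  exact/diff_derivable/(act_diff sg Wz).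
by have := deriveM df dg; rewrite /= vK => H; exact: H.
Qed.

Lemma act_addv W X Y f z : smooth_fun A W f -> W z ->
  act A (X \+ Y) f z = act A X f z + act A Y f z.
Proof. by move=> sf Wz; apply: derive_addv; exact: act_diff sf Wz. Qed.

Lemma act_scalev W (a : T -> R^o) X f z : smooth_fun A W f -> W z ->
  act A (fscale a X) f z = a z * act A X f z.
Proof. by move=> sf Wz; apply: derive_scalev; exact: act_diff sf Wz. Qed.

(** In the preferred chart both iterated derivatives contain the second
    derivative of f along X z and Y z, in opposite orders; by symmetry it
    cancels and what is left is the derivative of f along the bracket. Neither
    side of the result mentions a chart. *)
Lemma act_bracket W X Y f z : open_in A W -> smooth_vf A W X ->
  smooth_vf A W Y -> smooth_fun A W f -> W z ->
  act A (bracket A X Y) f z = act A X (act A Y f) z - act A Y (act A X f) z.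
Proof.
move=> oW sX sY sf Wz; have zc := chart_atP sA z.
pose c := cz z; pose p := phi A c z.
pose F := f \o psi A c; have sf2 : Ck 2 (img c W) F by exact: sf 2 c.
have Op : img c W p by exact: mem_img.
have lE V : local_rep c V p = V z by rewrite local_repE // tcoord_id.
have actE V V' : smooth_vf A W V' -> act A V (act A V' f) z =
   'D_('D_(V z) (local_rep c V') p) F p + 'D_(V z) ('D_(V' z) F) p.
  move=> sV'; have dV' : differentiable (local_rep c V') p.
    by have [+ _] := sV' c 1; apply.
  have := derive_along_derive (V z) (oW c) Op dV' sf2; rewrite (lE V') => <-.
  apply: near_eq_derive.
  have := near_img oW Wz zc; apply: filterS => q /imgP[Wq cq qE] /=.
  by rewrite (act_chart V' sf Wq cq) qE.
have DC := derive_comm (Y z) (X z) (oW c) Op sf2.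
have dF : differentiable F p by exact: (act_diff sf Wz).
have -> : act A (bracket A X Y) f z =
   'D_('D_(X z) (local_rep c Y) p) F p - 'D_('D_(Y z) (local_rep c X) p) F p.
  have := derive_addv ('D_(X z) (local_rep c Y) p)
    (- 'D_(Y z) (local_rep c X) p) dF.
  by rewrite -scaleN1r (derive_scalev _ _ dF) !scaleN1r => H; exact: H.
have cancel (a b d d' x y : R^o) :
    d = d' -> x = a + d -> y = b + d' -> a - b = x - y.
  by move=> -> -> ->; rewrite opprD addrACA subrr addr0.
exact: (cancel _ _ _ _ _ _ DC (actE X Y sY) (actE Y X sX)).
Qed.

(** The bracket is defined in a chart that changes from point to point; its
    components in a fixed chart i are X (Y x) - Y (X x) for the coordinates x of
    that chart, hence smooth. *)
Lemma smooth_bracket W X Y : open_in A W -> smooth_vf A W X ->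
  smooth_vf A W Y -> smooth_vf A W (bracket A X Y).
Proof.
move=> oW sX sY; apply: smooth_vfP => // i k.
have oWi := open_in_setI oW (open_in_dom i).
have sub V : smooth_vf A W V -> smooth_vf A (W `&` dom A i) V.
  by apply: smooth_vf_sub => z [].
have sx : smooth_fun A (W `&` dom A i) (coordf i k).
  by apply: smooth_fun_sub (smooth_coordf i k) => z [].
have sXx := sub _ sX; have sYx := sub _ sY.
apply: (@smooth_fun_eq _ (fun z => act A X (act A Y (coordf i k)) z -
   act A Y (act A X (coordf i k)) z)) => //.
  by move=> z Wz; rewrite (act_bracket oWi).
by apply: smooth_fun_subr => //; apply: smooth_fun_act => //; exact: smooth_fun_act.
Qed.
End AtlasCalculus.

(** * The Lie algebra of vector fields *)

Lemma cyclic_cancel {R : realType} (t t' t0 t1 t2 t3 a b c d e g : R) :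
  t = t' + t3 -> t' = t1 + t2 ->
  t1 = a - b - (c - d) -> t2 = c - e - (g - b) -> t3 = g - d - (a - e) ->
  t0 = 0 -> t = t0.
Proof. by move=> -> -> -> -> -> ->; lra. Qed.

Section LieAlgebra.
Context {R : realType} {m : nat} {T : Type} (A : atlas R m T).
Hypothesis sA : smooth_atlas A.
Implicit Types (W : set T) (X Y Z : @vf R m T) (f g : T -> R^o).

Local Notation cz z := (chart_at A z).

Lemma vf_eq_derivation W X Y z : open_in A W -> W z ->
  (forall W' f, open_in A W' -> W' z -> W' `<=` W -> smooth_fun A W' f ->
    act A X f z = act A Y f z) ->
  X z = Y z.
Proof.
move=> oW Wz H; apply: (vf_eq_act sA) => k.
apply: (H (W `&` dom A (cz z))).
- by apply: open_in_setI => //; exact: open_in_dom.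
- by split => //; exact: chart_atP.
- by move=> w [].
- by apply: smooth_fun_sub (smooth_coordf sA _ k) => w [].
Qed.

Lemma smooth_vf_add W X Y : open_in A W ->
  smooth_vf A W X -> smooth_vf A W Y -> smooth_vf A W (X \+ Y).
Proof.
move=> oW sX sY; apply: (smooth_vfP sA oW) => i k.
have oWi : open_in A (W `&` dom A i).
  by apply: open_in_setI => //; exact: open_in_dom.
have := smooth_fun_add oWi (smooth_act_coordf sA i k oW sX)
  (smooth_act_coordf sA i k oW sY).
apply: (smooth_fun_eq sA oWi) => z [Wz iz].
by rewrite (act_addv sA _ _ (smooth_coordf sA i k) iz).
Qed.

Lemma smooth_vf_scale W f X : open_in A W ->
  smooth_fun A W f -> smooth_vf A W X -> smooth_vf A W (fscale f X).
Proof.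
move=> oW sf sX; apply: (smooth_vfP sA oW) => i k.
have oWi : open_in A (W `&` dom A i).
  by apply: open_in_setI => //; exact: open_in_dom.
have sfi : smooth_fun A (W `&` dom A i) f by apply: smooth_fun_sub sf => z [].
have := smooth_fun_mul oWi sfi (smooth_act_coordf sA i k oW sX).
apply: (smooth_fun_eq sA oWi) => z [Wz iz].
by rewrite (act_scalev sA _ _ (smooth_coordf sA i k) iz).
Qed.

Lemma smooth_vf_opp W X : open_in A W -> smooth_vf A W X ->
  smooth_vf A W (fun z => - X z).
Proof.
move=> oW sX; apply: (smooth_vf_eq sA oW) (smooth_vf_scale oW
  (smooth_fun_cst W (-1 : R^o)) sX) => z _.
by rewrite /fscale scaleN1r.
Qed.

Lemma smooth_vf_subr W X Y : open_in A W ->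
  smooth_vf A W X -> smooth_vf A W Y -> smooth_vf A W (X \- Y).
Proof.
move=> oW sX sY; exact: (smooth_vf_add oW sX (smooth_vf_opp oW sY)).
Qed.

Lemma smooth_vf0 W : open_in A W -> smooth_vf A W (fun=> 0).
Proof.
move=> oW i k; have := Ck_cst k (phi A i @` (W `&` dom A i)) (0 : 'rV[R]_m).
apply: (Ck_eq (oW i)) => q [z [Wz iz] <-].
have := tcoordZ sA 0 0 (chart_atP sA z) iz.
by rewrite local_repE // !scale0r.
Qed.

Lemma bracketC X Y z : bracket A X Y z = - bracket A Y X z.
Proof. by rewrite /bracket opprB. Qed.

Lemma bracket_eq W X X' Y Y' z : open_in A W -> W z ->
  (forall w, W w -> X w = X' w) -> (forall w, W w -> Y w = Y' w) ->
  bracket A X Y z = bracket A X' Y' z.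
Proof.
move=> oW Wz XX YY.
have E V V' a : (forall w, W w -> V w = V' w) ->
    'D_a (local_rep (cz z) V) (phi A (cz z) z) =
    'D_a (local_rep (cz z) V') (phi A (cz z) z).
  move=> VV; apply: near_eq_derive.
  have := near_img oW Wz (chart_atP sA z); apply: filterS => q /(imgP sA)[Wq _ _].
  by rewrite /local_rep VV.
rewrite /bracket (XX _ Wz) (YY _ Wz).
have congrB (a b c d : 'rV[R]_m) : a = c -> b = d -> a - b = c - d.
  by move=> -> ->.
exact: congrB (E Y Y' (X' z) YY) (E X X' (Y' z) XX).
Qed.

Lemma act_zero f z : act A (fun=> 0 : 'rV[R]_m) f z = 0.
Proof. exact: derive0. Qed.

Lemma addvE X Y z : (X \+ Y) z = X z + Y z. Proof. by []. Qed.
Lemma subvE X Y z : (X \- Y) z = X z - Y z. Proof. by []. Qed.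
Lemma scalevE f X z : fscale f X z = f z *: X z. Proof. by []. Qed.

Lemma tcoord_sum i j z n (a : 'I_n -> R) v : dom A i z -> dom A j z ->
  tcoord A i j z (\sum_k a k *: v k) = \sum_k a k *: tcoord A i j z (v k).
Proof. by move=> iz jz; apply: derive_sumZ; exact: transition_diff. Qed.

Lemma tcoordE i j z v : tcoord A i j z v = 'D_v (phi A j \o psi A i) (phi A i z).
Proof. by []. Qed.

(* From here on these are used through their laws only. *)
Opaque act bracket local_rep tcoord fscale Algebra.add_fun Algebra.sub_fun.

Section Brackets.
Variables (W : set T) (z : T).
Hypotheses (oW : open_in A W) (Wz : W z).

Let sub W' X : W' `<=` W -> smooth_vf A W X -> smooth_vf A W' X.
Proof. exact: smooth_vf_sub. Qed.

(** The laws of the bracket hold because both sides act alike on functions. *)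
Lemma bracketDr X Y Z : smooth_vf A W X -> smooth_vf A W Y -> smooth_vf A W Z ->
  bracket A X (Y \+ Z) z = bracket A X Y z + bracket A X Z z.
Proof.
move=> sX sY sZ.
rewrite -addvE.
apply: (vf_eq_derivation oW Wz) => W' f oW' W'z W'W sf.
have [sX' sY' sZ'] := And3 (sub W'W sX) (sub W'W sY) (sub W'W sZ).
have sYZ := smooth_vf_add oW' sY' sZ'.
have sXf := smooth_fun_act sA oW' sX' sf.
have sYf := smooth_fun_act sA oW' sY' sf.
have sZf := smooth_fun_act sA oW' sZ' sf.
have e1 := act_bracket sA oW' sX' sYZ sf W'z.
have e2 : act A X (act A (Y \+ Z) f) z = act A X (fun w => act A Y f w + act A Z f w) z.
  apply: (act_eq sA oW' W'z erefl) => w W'w; exact: (act_addv sA Y Z sf W'w).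
have e3 := act_addf sA X sYf sZf W'z.
have e4 := act_addv sA Y Z sXf W'z.
have e5 := act_addv sA (bracket A X Y) (bracket A X Z) sf W'z.
have e6 := act_bracket sA oW' sX' sY' sf W'z.
have e7 := act_bracket sA oW' sX' sZ' sf W'z.
have alg (b p p' p1 p2 q q1 q2 s s1 s2 : R^o) : b = p - q -> p = p' ->
    p' = p1 + p2 -> q = q1 + q2 -> s = s1 + s2 -> s1 = p1 - q1 -> s2 = p2 - q2 ->
    b = s.
  by move=> -> -> -> -> -> -> ->; rewrite opprD addrACA.
exact: alg e1 e2 e3 e4 e5 e6 e7.
Qed.

Lemma bracketZr f X Y : smooth_fun A W f -> smooth_vf A W X ->
  smooth_vf A W Y ->
  bracket A X (fscale f Y) z = act A X f z *: Y z + f z *: bracket A X Y z.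
Proof.
move=> sf sX sY.
rewrite -!scalevE -addvE.
apply: (vf_eq_derivation oW Wz) => W' g oW' W'z W'W sg.
have [sX' sY'] := conj (sub W'W sX) (sub W'W sY).
have sf' : smooth_fun A W' f by exact: smooth_fun_sub sf.
have sfY := smooth_vf_scale oW' sf' sY'.
have sXg := smooth_fun_act sA oW' sX' sg.
have sYg := smooth_fun_act sA oW' sY' sg.
have e1 := act_bracket sA oW' sX' sfY sg W'z.
have e2 : act A X (act A (fscale f Y) g) z = act A X (fun w => f w * act A Y g w : R^o) z.
  apply: (act_eq sA oW' W'z erefl) => w W'w; exact: (act_scalev sA f Y sg W'w).
have e3 := act_mulf sA X sf' sYg W'z.
have e4 := act_scalev sA f Y sXg W'z.
have e5 := act_addv sA (fscale (act A X f) Y) (fscale f (bracket A X Y)) sg W'z.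
have e6 := act_scalev sA (act A X f) Y sg W'z.
have e7 := act_scalev sA f (bracket A X Y) sg W'z.
have e8 := act_bracket sA oW' sX' sY' sg W'z.
have alg (b b' p p' q q' s s1 s2 c y a x : R^o) : b = p - q -> p = p' ->
    p' = a * x + y * c -> q = a * q' -> s = s1 + s2 -> s1 = c * y ->
    s2 = a * b' -> b' = x - q' -> b = s.
  move=> -> -> -> -> -> -> -> ->.
  by rewrite mulrBr [y * c]mulrC addrCA addrA.
exact: alg e1 e2 e3 e4 e5 e6 e7 e8.
Qed.

Lemma bracketDl X Y Z : smooth_vf A W X -> smooth_vf A W Y -> smooth_vf A W Z ->
  bracket A (X \+ Y) Z z = bracket A X Z z + bracket A Y Z z.
Proof.
move=> sX sY sZ.
have alg (b b' x x' y y' : 'rV[R]_m) : b = - b' -> b' = x' + y' -> x = - x' ->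
    y = - y' -> b = x + y by move=> -> -> -> ->; exact: opprD.
exact: alg (bracketC _ _ _) (bracketDr sZ sX sY) (bracketC _ _ _) (bracketC _ _ _).
Qed.

Lemma bracketZl f X Y : smooth_fun A W f -> smooth_vf A W X ->
  smooth_vf A W Y ->
  bracket A (fscale f X) Y z = f z *: bracket A X Y z - act A Y f z *: X z.
Proof.
move=> sf sX sY.
have alg (s t : R) (b b' x c d : 'rV[R]_m) : b = - b' -> b' = s *: x + t *: c ->
    d = - c -> b = t *: d - s *: x.
  by move=> -> -> ->; rewrite opprD scalerN addrC.
exact: alg (bracketC _ _ _) (bracketZr sf sY sX) (bracketC _ _ _).
Qed.

(** The Jacobi identity of the commutator of derivations. *)
Lemma bracket_jacobi X Y Z :
  smooth_vf A W X -> smooth_vf A W Y -> smooth_vf A W Z ->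
  bracket A X (bracket A Y Z) z + bracket A Y (bracket A Z X) z +
  bracket A Z (bracket A X Y) z = 0.
Proof.
move=> sX sY sZ.
rewrite -!addvE -[RHS]/((fun=> 0 : 'rV[R]_m) z).
apply: (vf_eq_derivation oW Wz) => W' f oW' W'z W'W sf.
have [sX' sY' sZ'] := And3 (sub W'W sX) (sub W'W sY) (sub W'W sZ).
have E U1 U2 U3 : smooth_vf A W' U1 -> smooth_vf A W' U2 -> smooth_vf A W' U3 ->
    act A (bracket A U1 (bracket A U2 U3)) f z =
    act A U1 (act A U2 (act A U3 f)) z - act A U1 (act A U3 (act A U2 f)) z -
    (act A U2 (act A U3 (act A U1 f)) z - act A U3 (act A U2 (act A U1 f)) z).
  move=> s1 s2 s3.
  have s1f := smooth_fun_act sA oW' s1 sf.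
  have s2f := smooth_fun_act sA oW' s2 sf.
  have s3f := smooth_fun_act sA oW' s3 sf.
  have s23 := smooth_bracket sA oW' s2 s3.
  have e1 := act_bracket sA oW' s1 s23 sf W'z.
  have e2 := act_bracket sA oW' s2 s3 s1f W'z.
  have e3 : act A U1 (act A (bracket A U2 U3) f) z =
      act A U1 (fun w => act A U2 (act A U3 f) w - act A U3 (act A U2 f) w) z.
    apply: (act_eq sA oW' W'z erefl) => w W'w; exact: (act_bracket sA oW' s2 s3 sf W'w).
  have e4 := act_subf sA U1 (smooth_fun_act sA oW' s2 s3f)
    (smooth_fun_act sA oW' s3 s2f) W'z.
  exact: etrans e1 (congr2 (fun x y : R^o => x - y) (etrans e3 e4) e2).
have e0 := act_zero f z.
have e1 := act_addv sA (bracket A X (bracket A Y Z) \+ bracket A Y (bracket A Z X))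
  (bracket A Z (bracket A X Y)) sf W'z.
have e2 := act_addv sA (bracket A X (bracket A Y Z)) (bracket A Y (bracket A Z X))
  sf W'z.
exact: cyclic_cancel e1 e2 (E _ _ _ sX' sY' sZ') (E _ _ _ sY' sZ' sX')
  (E _ _ _ sZ' sX' sY') e0.
Qed.

End Brackets.

(** * Local frames and tensoriality *)

Lemma smooth_fun_chart W c (g : 'rV[R]_m -> R^o) : open_in A W -> W `<=` dom A c ->
  (forall k, Ck k (phi A c @` (W `&` dom A c)) g) ->
  smooth_fun A W (fun w => g (phi A c w)).
Proof.
move=> oW Wc sg k j.
apply: (@Ck_comp _ _ _ _ _ _ (phi A c \o psi A j) g (oW j) _ _ (sg k)).
  by move=> q /(imgP sA)[Wq jq qE]; apply: mem_img => //; exact: Wc.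
apply: Ck_sub (transition_Ck sA j c k) => q [w [Ww jw] <-].
by exists w => //; split => //; exact: Wc.
Qed.

Lemma ext_id z a : ext A z a z = a.
Proof. by rewrite /ext tcoord_id //; exact: chart_atP. Qed.

Lemma local_rep_ext z a i w : dom A (cz z) w -> dom A i w ->
  local_rep i (ext A z a) (phi A i w) = tcoord A (cz z) i w a.
Proof.
move=> cw iw; rewrite (local_repE sA _ iw) /ext.
exact: (tcoord_comp sA _ cw (chart_atP sA w) iw).
Qed.

(** In a chart i the components of the field are the derivative along a of the
    transition map from the preferred chart at z. *)
Lemma smooth_ext z a : smooth_vf A (dom A (cz z)) (ext A z a).
Proof.
have oc := @open_in_dom _ _ _ _ sA (cz z); apply: (smooth_vfP sA oc) => i k.
have oci : open_in A (dom A (cz z) `&` dom A i).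
  by apply: open_in_setI => //; exact: open_in_dom.
have sg l : Ck l (phi A (cz z) @` (dom A (cz z) `&` dom A i `&` dom A (cz z)))
    (fun q => 'D_a (phi A i \o psi A (cz z)) q 0 k : R^o).
  have [_ /(_ a)] := transition_Ck sA (cz z) i l.+1.
  move/(Ck_coord k (@overlap_open _ _ _ _ sA _ _)); apply: Ck_sub.
  by move=> q [w [[cw iw] _] <-]; exists w.
have := smooth_fun_chart oci (@subIsetl _ _ _) sg.
apply: (smooth_fun_eq sA oci) => w [cw iw].
by rewrite (act_coordf sA _ _ iw) (local_rep_ext _ cw iw) tcoordE.
Qed.

(** A tensor is given as an operator on fields, with laws for fields smooth on
    an open set; these laws at z determine its value there from the value of
    the field at z, see tensorial_eq. *)
Definition tensorial_at (V : lmodType R) W z (Q : @vf R m T -> V) : Prop :=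
  forall W', open_in A W' -> W' z -> W' `<=` W ->
  forall X Y f, smooth_vf A W' X -> smooth_vf A W' Y -> smooth_fun A W' f ->
  Q (X \+ Y) = Q X + Q Y /\ Q (fscale f X) = f z *: Q X.

(** A field that vanishes on W equals its product with the indicator of the
    complement of W. This indicator is zero, hence smooth, on W, so an operator
    that is linear over functions smooth on W cannot see the field. Locality
    follows without any cutoff function. *)
Lemma fscale_indicator W X : (forall w, W w -> X w = 0) ->
  exists2 f, (forall w, W w -> f w = 0) & X = fscale f X.
Proof.
move=> X0; exists (fun w => if `[< W w >] then 0 else 1).
  by move=> w Ww; case: asboolP.
apply/funext => w; rewrite scalevE; case: asboolP => [Ww|_].
  by rewrite X0 // scale0r.
by rewrite scale1r.
Qed.

Lemma smooth_fun_eq0 W f : open_in A W -> (forall w, W w -> f w = 0) ->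
  smooth_fun A W f.
Proof.
move=> oW f0; apply: (smooth_fun_eq sA oW) (smooth_fun_cst W (0 : R^o)).
by move=> w Ww; rewrite f0.
Qed.

Lemma smooth_vf_eq0 W X : open_in A W -> (forall w, W w -> X w = 0) ->
  smooth_vf A W X.
Proof.
move=> oW X0; apply: (smooth_vf_eq sA oW) (smooth_vf0 oW).
by move=> w Ww; rewrite X0.
Qed.

Section Tensoriality.
Variables (V : lmodType R) (W : set T) (z : T) (Q : @vf R m T -> V).
Hypotheses (oW : open_in A W) (Wz : W z) (tQ : tensorial_at W z Q).

Lemma tensorial_local0 W' X : open_in A W' -> W' z -> W' `<=` W ->
  (forall w, W' w -> X w = 0) -> Q X = 0.
Proof.
move=> oW' W'z W'W X0; have [f f0 XE] := fscale_indicator X0.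
have sX := smooth_vf_eq0 oW' X0; have sf := smooth_fun_eq0 oW' f0.
have [_] := tQ oW' W'z W'W sX sX sf.
by rewrite -XE f0 // scale0r.
Qed.

(** In the constant frame of the preferred chart at z, X is a combination with
    coefficients that vanish at z, up to a field that is zero near z. *)
Lemma tensorial0 X : smooth_vf A W X -> X z = 0 -> Q X = 0.
Proof.
move=> sX Xz; set c := cz z; have zc := chart_atP sA z.
pose W' := W `&` dom A c.
have oW' : open_in A W' by apply: open_in_setI => //; exact: open_in_dom.
have W'z : W' z by [].
have W'W : W' `<=` W by move=> w [].
pose f k := act A X (coordf c k); pose e k := ext A z (delta_mx 0 k).
pose comb r := foldr (fun k Y => fscale (f k) (e k) \+ Y) (fun=> 0 : 'rV[R]_m) r.
have sf k : smooth_fun A W' (f k) by exact: smooth_act_coordf.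
have se k : smooth_vf A W' (e k).
  by apply: smooth_vf_sub (smooth_ext _ _) => w [].
have sfe k := smooth_vf_scale oW' (sf k) (se k).
have scomb r : smooth_vf A W' (comb r).
  elim: r => [|k r IH]; [exact: smooth_vf0|exact: (smooth_vf_add oW' (sfe k) IH)].
have Qcomb r : Q (comb r) = 0.
  elim: r => [|k r IH] /=; first exact: (@tensorial_local0 W').
  have [-> _] := tQ oW' W'z W'W (sfe k) (scomb r) (sf k).
  have [_ ->] := tQ oW' W'z W'W (se k) (se k) (sf k).
  by rewrite IH addr0 /f act_coordf // local_repE // tcoord_id // Xz mxE scale0r.
have combE r w : comb r w = \sum_(k <- r) f k w *: e k w.
  elim: r => [|k r IH] /=; first by rewrite big_nil.
  by rewrite big_cons addvE scalevE IH.
have rest w : W' w -> (X \- comb (enum 'I_m)) w = 0.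
  case=> Ww cw; apply/eqP; rewrite subvE subr_eq0 combE big_enum /=; apply/eqP.
  have wc := chart_atP sA w.
  have -> : X w = tcoord A c (cz w) w (local_rep c X (phi A c w)).
    by rewrite local_repE // tcoord_comp // tcoord_id.
  rewrite {1}(row_sum_delta (local_rep c X (phi A c w))) (tcoord_sum _ _ cw wc).
  by apply: eq_bigr => k _; rewrite /f (act_coordf sA _ _ cw).
have sX' : smooth_vf A W' X by exact: smooth_vf_sub sX.
have sr := smooth_vf_subr oW' sX' (scomb (enum 'I_m)).
have -> : X = (X \- comb (enum 'I_m)) \+ comb (enum 'I_m).
  by apply/funext => w; rewrite addvE subvE subrK.
have [-> _] := tQ oW' W'z W'W sr (scomb (enum 'I_m)) (smooth_fun_cst W' (0 : R^o)).
by rewrite Qcomb addr0; exact: (tensorial_local0 oW' W'z W'W rest).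
Qed.

Lemma tensorial_eq X Y : smooth_vf A W X -> smooth_vf A W Y -> X z = Y z ->
  Q X = Q Y.
Proof.
move=> sX sY XY; have sXY := smooth_vf_subr oW sX sY.
have -> : X = (X \- Y) \+ Y by apply/funext => w; rewrite addvE subvE subrK.
have [-> _] := tQ oW Wz (@subset_refl _ W) sXY sY (smooth_fun_cst W (0 : R^o)).
by rewrite (tensorial0 sXY) ?add0r // subvE XY subrr.
Qed.

End Tensoriality.

End LieAlgebra.

(** * The atlas of a manifold and of its tangent bundle *)

Section ManifoldAtlas.
Context {R : realType} {n : nat} {M : topologicalType} (A : atlas R n M).
Hypothesis HM : smooth_manifold A.

(** The image of G in a chart is its preimage under the continuous inverse
    chart. *)
Lemma manifold_open_in (G : set M) : open G -> open_in A G.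
Proof.
move=> oG i; case: HM => _ _ _ oD oI psiK' _ cpsi _.
rewrite openE => q [z [Gz iz] <-].
have near_dom : \forall q \near phi A i z, (phi A i @` dom A i) q.
  by apply: open_nbhs_nbhs; split; [exact: oI|exists z].
have near_G : \forall q \near phi A i z, G (psi A i q).
  have iz' : phi A i z \in phi A i @` dom A i by apply: mem_set; exists z.
  by apply: (cpsi i _ iz'); rewrite psiK' //; exact: open_nbhs_nbhs.
rewrite /interior /=; near=> p.
have [w iw wp] : (phi A i @` dom A i) p by near: p.
have : G (psi A i p) by near: p.
by rewrite -wp psiK' // => Gw; exists w.
Unshelve. all: by end_near. Qed.

Lemma manifold_atlas : smooth_atlas A.
Proof.
case: (HM) => _ _ cat oD _ psiK' _ _ tr; split => //.
move=> i j; rewrite setIC.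
have oj : open_in A (dom A j) by apply: manifold_open_in; exact: oD.
exact: oj i.
Qed.

End ManifoldAtlas.

Section SubmatrixLinear.
Context {R : realType} {n1 n2 : nat}.

Lemma Ck_lsubmx k (O : set 'rV[R]_(n1 + n2)) : Ck k O (@lsubmx R 1 n1 n2).
Proof.
apply: (@Ck_linear _ _ _ k O (@lsubmx R 1 n1 n2)) => q.
by apply: differentiable_continuous; exact: differentiable_lsubmx.
Qed.

Lemma Ck_rsubmx k (O : set 'rV[R]_(n1 + n2)) : Ck k O (@rsubmx R 1 n1 n2).
Proof.
apply: (@Ck_linear _ _ _ k O (@rsubmx R 1 n1 n2)) => q.
by apply: differentiable_continuous; exact: differentiable_rsubmx.
Qed.

Lemma open_lsubmx (G : set 'rV[R]_n1) : open G ->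
  open [set q : 'rV[R]_(n1 + n2) | G (lsubmx q)].
Proof.
move=> oG; apply: (@open_comp _ _ (@lsubmx R 1 n1 n2) G) => // q _.
by apply: differentiable_continuous; exact: differentiable_lsubmx.
Qed.

Lemma open_rsubmx (G : set 'rV[R]_n2) : open G ->
  open [set q : 'rV[R]_(n1 + n2) | G (rsubmx q)].
Proof.
move=> oG; apply: (@open_comp _ _ (@rsubmx R 1 n1 n2) G) => // q _.
by apply: differentiable_continuous; exact: differentiable_rsubmx.
Qed.

Lemma derive_lsubmx q (v : 'rV[R]_(n1 + n2)) :
  'D_v (@lsubmx R 1 n1 n2) q = lsubmx v.
Proof.
have c : continuous (@lsubmx R 1 n1 n2).
  by move=> p; apply: differentiable_continuous; exact: differentiable_lsubmx.
by rewrite deriveE ?diff_lin //; exact: differentiable_lsubmx.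
Qed.

End SubmatrixLinear.

Section TangentMap.
Context {R : realType} {n : nat}.
Variables (O : set 'rV[R]_n) (t : 'rV[R]_n -> 'rV[R]_n).
Hypotheses (oO : open O) (Ct : forall k, Ck k O t).

(** (x, y) |-> (t x, dt_x y) *)
Definition tangent_map (q : 'rV[R]_(n + n)) : 'rV[R]_(n + n) :=
  row_mx (t (lsubmx q)) ('D_(rsubmx q) t (lsubmx q)).

Local Notation TO := [set q : 'rV[R]_(n + n) | O (lsubmx q)].

Lemma tangent_map_Ck k : Ck k TO tangent_map.
Proof.
have oTO := open_lsubmx (n2 := n) oO.
have lO q : TO q -> O (lsubmx q) by [].
apply: Ck_row => // i; case: (split_ordP i) => j ->.
  have H := Ck_comp oTO lO (Ck_lsubmx k _) (Ck_coord j oO (Ct k)).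
  by apply: (Ck_eq oTO _ H) => q _; rewrite /= /tangent_map row_mxEl.
have [dt Dt] := Ct k.+1.
have H := Ck_sum oTO (fun l => Ck_mul oTO (Ck_coord l oTO (Ck_rsubmx k _))
   (Ck_comp oTO lO (Ck_lsubmx k _) (Ck_coord j oO (Dt (delta_mx 0 l))))).
apply: (Ck_eq oTO _ H) => q Oq; rewrite /= /tangent_map row_mxEr.
rewrite (derive_rowE _ (dt _ Oq)) summxE; apply: eq_bigr => l _.
by rewrite [RHS]mxE.
Qed.

Lemma tangent_map_diff q : O (lsubmx q) -> differentiable tangent_map q.
Proof. by move=> Oq; have [+ _] := tangent_map_Ck 1; apply. Qed.

Lemma lsubmx_derive_tangent_map q v : O (lsubmx q) ->
  lsubmx ('D_v tangent_map q) = 'D_(lsubmx v) t (lsubmx q).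
Proof.
move=> Oq; have dT := tangent_map_diff Oq.
have dt : differentiable t (lsubmx q) by have [+ _] := Ct 1; apply.
have dl p : differentiable (@lsubmx R 1 n n) p by exact: differentiable_lsubmx.
have := derive_compE v dT (dl (tangent_map q)).
rewrite [in RHS]derive_lsubmx => <-.
rewrite (_ : lsubmx \o tangent_map = t \o lsubmx); last first.
  by apply/funext => p; rewrite /= /tangent_map row_mxKl.
by rewrite (derive_compE v (dl q) dt) derive_lsubmx.
Qed.

(** For fixed x the map y |-> dt_x y is linear, so difference quotients in a
    vertical direction are constant. *)
Lemma derive_tangent_map_vertical q b : O (lsubmx q) ->
  'D_(row_mx 0 b) tangent_map q = row_mx 0 ('D_b t (lsubmx q)).
Proof.
move=> Oq; have dt : differentiable t (lsubmx q) by have [+ _] := Ct 1; apply.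
apply/cvg_lim => //; apply: cvg_near_cst; near=> h; have h0 : h != 0 by near: h; exact: nbhs_dnbhs_neq.
have E : tangent_map (h *: row_mx 0 b + q) =
    row_mx (t (lsubmx q)) (h *: 'D_b t (lsubmx q) + 'D_(rsubmx q) t (lsubmx q)).
  rewrite /tangent_map linearD linearZ /= row_mxKl scaler0 add0r.
  rewrite linearD linearZ /= row_mxKr.
  by rewrite (derive_addv _ _ dt) (derive_scalev _ _ dt).
rewrite /= E /tangent_map opp_row_mx add_row_mx subrr addrK scale_row_mx scaler0.
by rewrite scalerA (mulVf h0) scale1r.
Unshelve. all: by end_near. Qed.

End TangentMap.

Section TangentAtlas.
Context {R : realType} {n : nat} {M : Type} (A : atlas R n M).
Hypothesis sA : smooth_atlas A.
Local Notation TA := (tatlas A).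
Local Notation ov i j := (phi A i @` (dom A i `&` dom A j)).

Lemma tangent_img i (G : set M) :
  phi TA i @` ([set z | G (base z)] `&` dom TA i) =
  [set q | (phi A i @` (G `&` dom A i)) (lsubmx q)].
Proof.
apply/seteqP; split=> q.
  by case=> z [Gz iz] <- /=; rewrite row_mxKl; exists (base z).
case=> x [Gx ix] qx; exists (TVec x (tcoord A i (chart_at A x) x (rsubmx q))).
  by split.
rewrite /= (tcoord_comp sA _ ix (chart_atP sA x) ix) (tcoord_id sA _ ix) qx.
exact: hsubmxK.
Qed.

Lemma tangent_open_in (G : set M) : open_in A G ->
  open_in TA [set z | G (base z)].
Proof. by move=> oG i; rewrite tangent_img; exact: (open_lsubmx (n2 := n) (oG i)). Qed.

Lemma tangent_ov i j : phi TA i @` (dom TA i `&` dom TA j) =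
  [set q | ov i j (lsubmx q)].
Proof. by rewrite setIC (tangent_img i (dom A j)) [dom A j `&` _]setIC. Qed.

Lemma tangent_psiK i z : dom TA i z -> psi TA i (phi TA i z) = z.
Proof.
case: z => x v /= ix; rewrite row_mxKl row_mxKr psiK //.
by rewrite (tcoord_comp sA _ (chart_atP sA x) ix (chart_atP sA x)) (tcoord_id sA) //;
  exact: chart_atP.
Qed.

Lemma tangent_transition i j q : ov i j (lsubmx q) ->
  (phi TA j \o psi TA i) q = tangent_map (phi A j \o psi A i) q.
Proof.
move=> [x [ix jx] qx]; have E : psi A i (lsubmx q) = x by rewrite -qx psiK.
have D := tcoord_comp sA (rsubmx q) ix (chart_atP sA x) jx.
rewrite [RHS]tcoordE qx in D.
by rewrite /= /tangent_map [in LHS]E /= -D E.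
Qed.

Lemma tangent_atlas : smooth_atlas TA.
Proof.
split.
- by move=> z; exact: (chart_atP sA (base z)).
- exact: tangent_psiK.
- by move=> i j; rewrite tangent_ov; exact: (open_lsubmx (n2 := n) (@overlap_open _ _ _ _ sA i j)).
- move=> i j k; rewrite tangent_ov.
  have oO := open_lsubmx (n2 := n) (@overlap_open _ _ _ _ sA i j).
  apply: (Ck_eq oO _ (tangent_map_Ck (@overlap_open _ _ _ _ sA i j)
    (fun l => transition_Ck sA i j l) k)) => q Oq.
  by rewrite tangent_transition.
Qed.

Lemma tcoord_tangent i j z v : dom TA i z -> dom TA j z ->
  tcoord TA i j z v = 'D_v (tangent_map (phi A j \o psi A i)) (phi TA i z).
Proof.
move=> iz jz; apply: near_eq_derive.
have oO := open_lsubmx (n2 := n) (@overlap_open _ _ _ _ sA i j).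
have : nbhs (phi TA i z) [set q : 'rV[R]_(n + n) | ov i j (lsubmx q)].
  by apply: open_nbhs_nbhs; split => //=; exists (base z); rewrite ?row_mxKl.
by apply: filterS => q; exact: tangent_transition.
Qed.

Lemma lsubmx_tcoord i j z v : dom TA i z -> dom TA j z ->
  lsubmx (tcoord TA i j z v) = tcoord A i j (base z) (lsubmx v).
Proof.
move=> iz jz; rewrite tcoord_tangent //.
rewrite (lsubmx_derive_tangent_map (@overlap_open _ _ _ _ sA i j)
  (fun l => transition_Ck sA i j l)) /=; last first.
  by rewrite row_mxKl; exists (base z).
by rewrite row_mxKl tcoordE.
Qed.

Lemma tcoord_vertical i j z b : dom TA i z -> dom TA j z ->
  tcoord TA i j z (row_mx 0 b) = row_mx 0 (tcoord A i j (base z) b).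
Proof.
move=> iz jz; rewrite tcoord_tangent //.
rewrite (derive_tangent_map_vertical
  (fun l => transition_Ck sA i j l)) /=; last first.
  by rewrite row_mxKl; exists (base z).
by rewrite row_mxKl tcoordE.
Qed.

Lemma slit_open_in : open_in TA slit.
Proof.
move=> i; rewrite (_ : _ @` _ = [set q | (phi A i @` (setT `&` dom A i)) (lsubmx q)] `&`
   [set q | (~` [set (0 : 'rV[R]_n)]) (rsubmx q)]).
  apply: openI; first by apply: open_lsubmx; rewrite setTI -[dom A i]setIid; exact: (@overlap_open _ _ _ _ sA i i).
  by apply: open_rsubmx; apply: closed_openC; apply: accessible_closed_set1;
    apply: hausdorff_accessible; exact: norm_hausdorff.
apply/seteqP; split=> q.
  case=> z [sz iz] <- /=; rewrite row_mxKl row_mxKr; split; first by exists (base z).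
  move=> z0; move/eqP: sz; apply.
  rewrite -(tcoord_id sA (vec z) (chart_atP sA (base z))).
  rewrite -(tcoord_comp sA _ (chart_atP sA (base z)) iz (chart_atP sA (base z))) z0.
  by rewrite -(scale0r 0) (tcoordZ sA) ?scale0r //; exact: chart_atP.
case=> [[x [_ ix] qx] q0].
exists (TVec x (tcoord A i (chart_at A x) x (rsubmx q))).
  split => //; apply/eqP => /= z0; apply: q0.
  rewrite -(tcoord_id sA (rsubmx q) ix).
  rewrite -(tcoord_comp sA _ ix (chart_atP sA x) ix) z0.
  by rewrite -(scale0r 0) (tcoordZ sA) ?scale0r //; exact: chart_atP.
rewrite /= (tcoord_comp sA _ ix (chart_atP sA x) ix) (tcoord_id sA _ ix) qx.
exact: hsubmxK.
Qed.

(** Transition maps of TM act on vertical components as those of M act on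
    horizontal ones, so J has the same expression in every chart. *)
Lemma smooth_Jt W X : open_in TA W -> smooth_vf TA W X -> smooth_vf TA W (Jt X).
Proof.
move=> oW sX; apply: (smooth_vfP tangent_atlas oW) => i k.
have oWi : open_in TA (W `&` dom TA i).
  by apply: (open_in_setI tangent_atlas) => //; exact: open_in_dom tangent_atlas _.
have JE w : dom TA i w -> act TA (Jt X) (coordf i k) w =
    (row_mx 0 (lsubmx (local_rep (A := TA) i X (phi TA i w)))) 0 k.
  move=> iw; have cw := chart_atP tangent_atlas w.
  rewrite (act_coordf tangent_atlas _ _ iw) !(local_repE tangent_atlas _ iw).
  by rewrite /Jt (tcoord_vertical _ cw iw) (lsubmx_tcoord _ cw iw).
case: (split_ordP k) => j kj.
  apply: (smooth_fun_eq tangent_atlas oWi) (smooth_fun_cst _ (0 : R^o)).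
  by move=> w [_ iw]; rewrite JE // kj row_mxEl mxE.
apply: (smooth_fun_eq tangent_atlas oWi)
  (smooth_act_coordf tangent_atlas i (lshift n j) oW sX) => w [Ww iw].
by rewrite JE // kj row_mxEr mxE (act_coordf tangent_atlas _ _ iw).
Qed.

End TangentAtlas.

Section Jt_algebra.
Context {R : realType} {n : nat} {M : Type}.
Implicit Types X Y : @vf R (n + n) (tvec R n M).

Lemma Jt_pt X Y z : X z = Y z -> Jt X z = Jt Y z.
Proof. by rewrite /Jt => ->. Qed.

Lemma Jt_Jt X : Jt (Jt X) = (fun=> 0).
Proof. by apply/funext => z; rewrite /Jt row_mxKl row_mx0. Qed.

Lemma JtD X Y : Jt (X \+ Y) = Jt X \+ Jt Y.
Proof. by apply/funext => z; rewrite addvE /Jt addvE linearD add_row_mx addr0. Qed.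

Lemma Jt_eq0 X z : Jt X z = 0 -> exists b, X z = row_mx 0 b.
Proof.
rewrite /Jt => /(congr1 rsubmx); rewrite row_mxKr linear0 => X0.
by exists (rsubmx (X z)); rewrite -[LHS]hsubmxK X0.
Qed.
End Jt_algebra.

(** * Bump functions and global extension of vectors *)

Section FlatFunction.
Context {R : realType}.
Implicit Types (p : {poly R}) (t s : R).

Lemma exprn_le_expR s k : 0 <= s -> s ^+ k <= k`!%:R * expR s.
Proof.
move=> s0; case: k => [|k]; first by rewrite expr0 fact0 mul1r -expR0 ler_expR.
have := expR_ge1Dxn k s0; have k0 : 0 < (k.+1)`!%:R :> R by rewrite ltr0n fact_gt0.
by rewrite -ler_pdivrMl // [_^-1 * _]mulrC; apply: le_trans; rewrite lerDr ler01.
Qed.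

(** Bounding s^k by k! e^s term by term. *)
Lemma horner_le_expR p : exists2 C : R, 0 <= C &
  forall s, 0 <= s -> `|p.[s]| <= C * expR s.
Proof.
exists (\sum_(i < size p) `|p`_i| * i`!%:R).
  by apply: sumr_ge0 => i _; rewrite mulr_ge0.
move=> s s0; rewrite horner_coef mulr_suml.
apply: le_trans (ler_norm_sum _ _ _) _; apply: ler_sum => i _.
rewrite normrM -mulrA ler_wpM2l // ger0_norm ?exprn_ge0 //.
exact: exprn_le_expR.
Qed.

(** p (1/t) e^(-1/t) for positive t, extended by zero. This family is stable
    under differentiation, and contains the classical flat function for p = 1. *)
Definition flat p t : R := if 0 < t then p.[t^-1] * expR (- t^-1) else 0.

Lemma flat_small p : exists2 C : R, 0 <= C & forall t, `|flat p t| <= C * `|t|.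
Proof.
have [C C0 HC] := horner_le_expR (p * 'X); exists C => // t; rewrite /flat.
case: ifP => t0; last by rewrite normr0 mulr_ge0.
have s0 : 0 <= t^-1 by rewrite invr_ge0 ltW.
have := HC _ s0; rewrite hornerMX !normrM (ger0_norm s0) expRN.
rewrite (ger0_norm (_ : 0 <= (expR t^-1)^-1)); last by rewrite invr_ge0 expR_ge0.
move=> H; rewrite (gtr0_norm t0) ler_pdivrMr ?expR_gt0 // mulrAC.
by rewrite -ler_pdivrMr.
Qed.

(** Away from 0 this is the chain rule. At 0 the difference quotient of flat p
    is flat (p X), which tends to 0 because the exponential beats every
    polynomial. *)
Lemma is_derive_flat p t :
  is_derive t (1 : R) (flat p) (flat ((p - p^`()) * 'X^2) t).
Proof.
have [t0|t0|->] := ltgtP t 0.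
- have -> : flat ((p - p^`()) * 'X^2) t = 0 by rewrite /flat ltNge (ltW t0).
  apply: (near_eq_is_derive (f := cst 0)).
  near=> x; rewrite /flat /cst ifF //; apply/negbTE; rewrite -leNgt ltW //.
  by near: x; exact: lt_nbhsl.
- have tn0 : t != 0 by rewrite gt_eqF.
  have dV : is_derive t (1 : R) (fun x : R => x^-1) (- t^-1 ^+ 2).
    have := is_deriveV tn0 (is_derive_id t (1 : R)).
    by move=> H; apply: is_derive_eq H _; rewrite /GRing.scale /= mulr1 exprVn.
  have dp : is_derive t^-1 (1 : R) (horner p) (p^`().[t^-1]).
    apply: DeriveDef; first exact: derivable_horner.
    by rewrite -derive1E -derivE.
  have dPV := is_derive1_comp dp dV.
  have dN : is_derive t (1 : R) (fun x : R => - x^-1) (- - t^-1 ^+ 2).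
    exact: is_deriveN dV.
  have dE : is_derive t (1 : R) (expR \o (fun x : R => - x^-1))
      (expR (- t^-1) * - - t^-1 ^+ 2).
    exact: (is_derive1_comp (g := fun x : R => - x^-1) (is_derive_expR _) dN).
  have near_t : \near t, (((horner p) \o (fun x : R => x^-1)) *
      (expR \o (fun x : R => - x^-1))) t = flat p t.
    near=> x; rewrite /flat ifT //; near: x; exact: lt_nbhsr.
  apply: is_derive_eq (near_eq_is_derive near_t (is_deriveM dPV dE)) _.
  rewrite /flat t0 hornerM hornerXn hornerD hornerN.
  rewrite -[LHS]/(p.[t^-1] * (expR (- t^-1) * - - t^-1 ^+ 2) +
    expR (- t^-1) * (p^`().[t^-1] * - t^-1 ^+ 2)).
  ring.
- have -> : flat ((p - p^`()) * 'X^2) 0 = 0 by rewrite /flat ltxx.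
  have [C C0 HC] := flat_small (p * 'X).
  have C1 : 0 < C + 1 by rewrite ltr_wpDl.
  have lim0 : h^-1 *: (flat p (h *: (1 : R) + 0) - flat p 0) @[h --> 0^'] --> (0 : R).
    apply/cvgrPdist_le => e e0; near=> h.
    have h0 : h != 0 by near: h; exact: nbhs_dnbhs_neq.
    rewrite sub0r normrN addr0 {2}/flat ltxx subr0 /GRing.scale /= mulr1.
    have -> : h^-1 * flat p h = flat (p * 'X) h.
      rewrite /flat; case: ifP => _; last by rewrite mulr0.
      by rewrite hornerMX; ring.
    apply: le_trans (HC h) _.
    apply: (@le_trans _ _ ((C + 1) * `|h|)); first by rewrite ler_wpM2r // lerDl.
    rewrite -ler_pdivlMl // mulrC; near: h; apply: dnbhs0_le; exact: divr_gt0.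
  by apply: DeriveDef; [apply/cvg_ex; exists 0|exact: (cvg_lim (@Rhausdorff R) lim0)].
Unshelve. all: by end_near. Qed.

Lemma Ck_flat (V : normedModType R) k (O : set V) p (f : V -> R^o) :
  open O -> Ck k O f -> Ck k O (fun q => flat p (f q) : R^o).
Proof.
have dflat t : differentiable (flat p : R^o -> R^o) t.
  by apply/derivable1_diffP; have [] := is_derive_flat p t.
move=> oO; elim: k p {dflat} f => [|k IH] p f Cf.
  move=> x xO; apply: (@continuous_comp _ _ _ f (flat p : R^o -> R^o)); first exact: Cf.
  by apply/differentiable_continuous/derivable1_diffP; have [] := is_derive_flat p (f x).
have dflat t : differentiable (flat p : R^o -> R^o) t.
  by apply/derivable1_diffP; have [] := is_derive_flat p t.
have [df Df] := Cf; split=> [q Oq|v].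
  exact: differentiable_comp (df _ Oq) (dflat _).
have := Ck_mul oO (Df v) (IH ((p - p^`()) * 'X^2) f (CkW Cf)).
apply: (Ck_eq oO) => q Oq.
have := derive_compE v (df _ Oq) (dflat (f q)) => ->.
have [_ E] := is_derive_flat p (f q).
have := derive_scalev ('D_v f q) (1 : R^o) (dflat (f q)).
rewrite {1}/GRing.scale /= mulr1 => ->; by rewrite E.
Qed.

Lemma flat1_gt0 t : 0 < t -> 0 < flat 1 t.
Proof. by move=> t0; rewrite /flat t0 hornerE mul1r expR_gt0. Qed.

Lemma flat_le0 p t : t <= 0 -> flat p t = 0.
Proof. by move=> t0; rewrite /flat ltNge t0. Qed.

End FlatFunction.

Section Bump.
Context {R : realType} {n : nat} {M : topologicalType} (A : atlas R n M).
Hypothesis HM : smooth_manifold A.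
Let sA := manifold_atlas HM.

(** In the chart c take the flat function of r^2 - |q - q0|^2, divided by its
    value at the image q0 of x. Here |.| is the Euclidean norm, and r is so small
    that the chart contains the closed ball B of radius r around q0 for the sup
    norm; outside B the function vanishes. The set K, image of the compact B, is
    closed because M is Hausdorff. *)
Lemma chart_bump c x : dom A c x -> exists (f : M -> R^o) (K : set M),
  [/\ closed K, K `<=` dom A c, f x = 1, (forall w, ~ K w -> f w = 0)
    & smooth_fun A (dom A c) f].
Proof.
move=> cx; pose q0 := phi A c x.
have oI : open (phi A c @` dom A c).
  by rewrite -[X in _ @` X]setIid; exact: (@overlap_open _ _ _ _ sA c c).
have /nbhs_closedballP [r rI] : nbhs q0 (phi A c @` dom A c).
  by apply: open_nbhs_nbhs; split => //; exists x.
pose B := closed_ball q0 r%:num.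
have cB : compact B.
  apply: bounded_closed_compact; last exact: closed_ball_closed.
  exists (`|q0| + r%:num); split => // y ry q.
  rewrite /B closed_ballE // /closed_ball_ /= distrC => qr.
  apply: ltW; apply: le_lt_trans ry; rewrite -[q](subrK q0) addrC.
  apply: le_trans (ler_normD _ _) _; by rewrite lerD2l.
pose K := psi A c @` B.
have clK : closed K.
  case: (HM) => hM _ _ _ _ _ _ cpsi _; apply: compact_closed => //.
  apply: continuous_compact => //; apply: continuous_in_subspaceT => q /set_mem Bq.
  by apply: (cpsi c); apply: mem_set; exact: rI.
pose s (q : 'rV[R]_n) : R^o := r%:num ^+ 2 - \sum_k (q 0 k - q0 0 k) ^+ 2.
have Cs k : Ck k (phi A c @` (dom A c `&` dom A c)) s.
  have o := @overlap_open _ _ _ _ sA c c.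
  have Cc (j : 'I_n) : Ck k (phi A c @` (dom A c `&` dom A c))
      (fun q : 'rV[R]_n => q 0 j - q0 0 j : R^o).
    exact: (Ck_add o (Ck_coord j o (Ck_id k _)) (Ck_cst k _ (- q0 0 j : R^o))).
  exact: (Ck_add o (Ck_cst k _ (r%:num ^+ 2 : R^o))
    (Ck_opp o (Ck_sum o (fun j => Ck_mul o (Cc j) (Cc j))))).
have s0 : 0 < s q0.
  rewrite /s big1 ?subr0 ?exprn_gt0 // => k _; by rewrite subrr expr0n.
pose b q : R^o := (flat 1 (s q0))^-1 * flat 1 (s q).
pose f w : R^o := if `[< dom A c w >] then b (phi A c w) else 0.
exists f, K; split => //.
- by move=> _ [q /rI[w cw <-] <-]; rewrite psiK.
- rewrite /f asboolT // /b -/q0 mulVf //; apply: lt0r_neq0; exact: flat1_gt0.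
- move=> w nK; rewrite /f; case: asboolP => // cw.
  suff s_le0 : s (phi A c w) <= 0 by rewrite /b (flat_le0 _ s_le0) mulr0.
  rewrite leNgt; apply/negP => sw; apply: nK.
  exists (phi A c w); last by rewrite psiK.
  rewrite /B closed_ballE // /closed_ball_ /=.
  rewrite [leLHS]/Num.Def.normr /= mx_normrE; apply: bigmax_le => // -[i k] _.
  rewrite ord1 /= !mxE distrC -(ler_pXn2r (ltn0Sn 1)) ?nnegrE //.
  rewrite real_normK ?num_real //; apply: le_trans (_ : _ <= \sum_k (phi A c w 0 k - q0 0 k) ^+ 2) _.
    by rewrite (bigD1 k) //= lerDl; apply: sumr_ge0 => j _; exact: sqr_ge0.
  by rewrite ltW // -subr_gt0.
- have Cb k : Ck k (phi A c @` (dom A c `&` dom A c)) b.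
    have o := @overlap_open _ _ _ _ sA c c.
    exact: (Ck_mul o (Ck_cst k _ _) (Ck_flat 1 o (Cs k))).
  have oc := @open_in_dom _ _ _ _ sA c.
  apply: (smooth_fun_eq sA oc) (smooth_fun_chart sA oc (@subset_refl _ _) Cb).
  by move=> w cw; rewrite /f asboolT.
Qed.

Let sTA := tangent_atlas sA.
Local Notation TA := (tatlas A).

Lemma smooth_fun_base W (f : M -> R^o) : open_in A W -> smooth_fun A W f ->
  smooth_fun TA [set z | W (base z)] (f \o @base R n M).
Proof.
move=> oW sf k i; rewrite (tangent_img sA).
have o := open_lsubmx (n2 := n) (oW i).
have H := Ck_comp o _ (Ck_lsubmx k _) (sf k i).
by apply: H.
Qed.

(** Cut off the chartwise constant extension of a by a bump function of the base
    point. The product is smooth over the domain of the chart, and zero over the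
    open complement of the support of the bump. *)
Lemma global_extension (z : tvec R n M) (a : 'rV[R]_(n + n)) :
  exists2 X : vf (tvec R n M), smooth_vf TA setT X & X z = a.
Proof.
pose c := chart_at A (base z).
have [f [K [clK Kc fz f0 sf]]] := chart_bump (chart_atP sA (base z)).
pose X := fscale (f \o @base R n M) (ext TA z a).
exists X; last by rewrite /X scalevE (ext_id sTA) /= fz scale1r.
have oc := @open_in_dom _ _ _ _ sA c.
have s1 : smooth_vf TA [set w | dom A c (base w)] X.
  apply: (smooth_vf_scale sTA (tangent_open_in sA oc)).
    exact: smooth_fun_base.
  exact: (smooth_ext sTA z a).
have oK : open_in A (~` K) by apply: (manifold_open_in HM); exact: closed_openC.
have s2 : smooth_vf TA [set w | (~` K) (base w)] X.
  apply: (smooth_vf_eq0 sTA (tangent_open_in sA oK)) => w nK.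
  by rewrite /X scalevE /= f0 // scale0r.
move=> i k; apply: Ck_local => q [w [_ iw] qE].
have [Kw|nKw] := pselect (K (base w)).
  exists (phi TA i @` ([set w | dom A c (base w)] `&` dom TA i)); last exact: s1.
  by exists w => //; split => //; exact: Kc.
exists (phi TA i @` ([set w | (~` K) (base w)] `&` dom TA i)); last exact: s2.
by exists w.
Qed.
End Bump.

(** * The Barthel projectors and the almost complex structure *)

Lemma half_double {R : realType} (V : lmodType R) (a : V) : 2^-1 *: (a + a) = a.
Proof.
have -> : a + a = (2 : R) *: a by rewrite scaler_nat mulr2n.
by rewrite scalerA mulVf ?scale1r ?pnatr_eq0.
Qed.

Section AlmostComplex.
Context {R : realType} {n : nat} {M : Type} (A : atlas R n M).
Hypothesis sA : smooth_atlas A.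
Let TM := tvec R n M.
Let TA := tatlas A.
Let sTA : smooth_atlas TA := tangent_atlas sA.
Let field := @vf R (n + n) TM.
Variables (S : field) (F : field -> field).
Hypothesis sS : smooth_vf TA slit S.
Hypothesis HF : almost_complex A S F.

Local Notation sm W X := (smooth_vf TA W X).
Local Notation h := (hproj A S).
Local Notation v := (vproj A S).
Local Notation br := (bracket TA).
Implicit Types (W : set TM) (X Y Z V : field) (z : TM).

Definition slit_open W := open_in TA W /\ W `<=` slit.

Lemma slit_open_dom W z : slit_open W -> W z ->
  exists W', [/\ slit_open W', W' z, W' `<=` W & W' `<=` dom TA (chart_at TA z)].
Proof.
move=> [oW Ws] Wz; exists (W `&` dom TA (chart_at TA z)); split.
- split; last by move=> w [/Ws].
  by apply: (open_in_setI sTA) => //; exact: (@open_in_dom _ _ _ _ sTA).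
- by split => //; exact: (chart_atP sTA).
- by move=> w [].
- by move=> w [].
Qed.

Lemma F_tensorial W z : slit_open W -> tensorial_at TA W z (fun X => F X z).
Proof.
move=> [_ Ws] W' oW' W'z W'W X Y f sX sY sf; case: HF => HT _.
have [_ FD FZ] := HT W' oW' (fun w Ww => Ws w (W'W w Ww)) X Y f sX sY sf.
by split; [exact: FD|exact: FZ].
Qed.

Lemma F_smooth W X : slit_open W -> sm W X -> sm W (F X).
Proof.
move=> [oW Ws] sX; case: HF => HT _.
by have [] := HT W oW Ws X X (fun=> 0) sX sX (smooth_fun_cst W (0 : R^o)).
Qed.

Lemma F_eq W X Y z : slit_open W -> W z -> sm W X -> sm W Y -> X z = Y z ->
  F X z = F Y z.
Proof.
move=> aW Wz; have [oW _] := aW.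
exact: (tensorial_eq sTA oW Wz (@F_tensorial W z aW)).
Qed.

Lemma F_add W X Y z : slit_open W -> W z -> sm W X -> sm W Y ->
  F (X \+ Y) z = F X z + F Y z.
Proof.
move=> aW Wz sX sY; have [oW _] := aW.
by have [] := F_tensorial aW oW Wz (@subset_refl _ W) sX sY (smooth_fun_cst W (0 : R^o)).
Qed.

Lemma F_J W X z : slit_open W -> W z -> sm W X -> F (Jt X) z = h X z.
Proof. by move=> [oW Ws] Wz sX; case: HF => _ H; have [] := H W oW Ws X sX z Wz. Qed.

Lemma J_smooth W X : slit_open W -> sm W X -> sm W (Jt X).
Proof. by move=> [oW _]; exact: (smooth_Jt sA oW). Qed.

Lemma h_smooth W X : slit_open W -> sm W X -> sm W (h X).
Proof.
move=> aW sX; have [oW _] := aW.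
apply: (smooth_vf_eq sTA oW) (F_smooth aW (J_smooth aW sX)) => z Wz.
exact: (F_J aW Wz sX).
Qed.

Lemma h_eq W X Y z : slit_open W -> W z -> sm W X -> sm W Y -> X z = Y z ->
  h X z = h Y z.
Proof.
move=> aW Wz sX sY XY; rewrite -(F_J aW Wz sX) -(F_J aW Wz sY).
exact: (F_eq aW Wz (J_smooth aW sX) (J_smooth aW sY) (Jt_pt XY)).
Qed.

Lemma h_add W X Y z : slit_open W -> W z -> sm W X -> sm W Y ->
  h (X \+ Y) z = h X z + h Y z.
Proof.
move=> aW Wz sX sY; have [oW _] := aW; have sXY := smooth_vf_add sTA oW sX sY.
rewrite -(F_J aW Wz sX) -(F_J aW Wz sY) -(F_J aW Wz sXY) JtD.
exact: (F_add aW Wz (J_smooth aW sX) (J_smooth aW sY)).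
Qed.

Lemma bracket_zero W X z : slit_open W -> W z -> sm W X ->
  br (fun=> 0 : 'rV[R]_(n + n)) X z = 0.
Proof.
move=> [oW _] Wz sX; have s0 := smooth_vf0 sTA oW.
have E : (fun=> 0 : 'rV[R]_(n + n)) \+ (fun=> 0) = (fun=> 0) :> field.
  by apply/funext => w; rewrite addvE addr0.
have := bracketDl sTA oW Wz s0 s0 sX; rewrite E.
by move/esym/eqP; rewrite -subr_eq0 addrK => /eqP.
Qed.

(** h = FJ and J J = 0. *)
Lemma h_J W X z : slit_open W -> W z -> sm W X -> h (Jt X) z = 0.
Proof.
move=> aW Wz sX; have [oW _] := aW; have s0 := smooth_vf0 sTA oW.
rewrite -(F_J aW Wz (J_smooth aW sX)) Jt_Jt.
exact: (tensorial0 sTA oW Wz (@F_tensorial W z aW) s0).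
Qed.

Definition Jm (a : 'rV[R]_(n + n)) : 'rV[R]_(n + n) := row_mx 0 (lsubmx a).

Lemma JtE X z : Jt X z = Jm (X z). Proof. by []. Qed.
Lemma Jm_add a b : Jm (a + b) = Jm a + Jm b.
Proof. by rewrite /Jm linearD add_row_mx addr0. Qed.
Lemma Jm_sub a b : Jm (a - b) = Jm a - Jm b.
Proof. by rewrite /Jm linearB opp_row_mx add_row_mx subr0. Qed.
Lemma Jm_scale c a : Jm (c *: a) = c *: Jm a.
Proof. by rewrite /Jm linearZ scale_row_mx scaler0. Qed.
Lemma Jm_Jm a : Jm (Jm a) = 0.
Proof. by rewrite /Jm row_mxKl row_mx0. Qed.

(** As h kills vertical vectors, the definition of h on JX leaves
    JX - J[JX,S] = 0: the spray is a second order vector field. *)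
Lemma J_bracket_spray W X z : slit_open W -> W z -> sm W X ->
  Jm (br (Jt X) S z) = Jt X z.
Proof.
move=> aW Wz sX; have [oW Ws] := aW; have sSW := smooth_vf_sub Ws sS.
have := h_J aW Wz sX.
rewrite /hproj /barthel /fn_bracket_vf subvE Jt_Jt (bracket_zero aW Wz sSW) sub0r.
rewrite !JtE => /eqP; rewrite scaler_eq0 invr_eq0 pnatr_eq0 /= subr_eq0.
by move/eqP.
Qed.

(** J Gamma X = J[JX,S] because J J = 0, so JhX is the mean of JX and JX. With
    h = FJ this makes h a projector along the vertical bundle. *)
Lemma J_h W X z : slit_open W -> W z -> sm W X -> Jm (h X z) = Jt X z.
Proof.
move=> aW Wz sX; rewrite /hproj /barthel /fn_bracket_vf subvE !JtE.
rewrite Jm_scale Jm_add Jm_sub Jm_Jm subr0 (J_bracket_spray aW Wz sX) JtE.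
exact: half_double.
Qed.

Lemma h_h W X z : slit_open W -> W z -> sm W X -> h (h X) z = h X z.
Proof.
move=> aW Wz sX; have shX := h_smooth aW sX.
rewrite -(F_J aW Wz shX) -(F_J aW Wz sX).
apply: (F_eq aW Wz (J_smooth aW shX) (J_smooth aW sX)).
by rewrite JtE (J_h aW Wz sX).
Qed.

Lemma vE X z : v X z = X z - h X z.
Proof.
rewrite /vproj /hproj -[X in _ = X - _]half_double -scalerBr.
have alg (a b : 'rV[R]_(n + n)) : a + a - (a + b) = a - b.
  by rewrite opprD addrACA subrr add0r.
by rewrite alg.
Qed.

Lemma v_smooth W X : slit_open W -> sm W X -> sm W (v X).
Proof.
move=> aW sX; have [oW _] := aW.
apply: (smooth_vf_eq sTA oW) (smooth_vf_subr sTA oW sX (h_smooth aW sX)) => z _.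
by rewrite vE.
Qed.

Lemma J_v W X z : slit_open W -> W z -> sm W X -> Jm (v X z) = 0.
Proof. by move=> aW Wz sX; rewrite vE Jm_sub (J_h aW Wz sX) JtE subrr. Qed.

(** Write the vertical vector as JY: then JFJY = JhY = JY. *)
Lemma J_F_vertical W V z : slit_open W -> W z -> sm W V -> Jm (V z) = 0 ->
  Jm (F V z) = V z.
Proof.
move=> aW Wz sV; rewrite -JtE => /Jt_eq0[b Vz].
have [W' [aW' W'z W'W W'c]] := slit_open_dom aW Wz; have [oW' _] := aW'.
pose Y := ext TA z (row_mx b 0).
have sY : sm W' Y by apply: smooth_vf_sub (smooth_ext sTA z _).
have sV' := smooth_vf_sub W'W sV.
have VJ : V z = Jt Y z by rewrite JtE /Y (ext_id sTA) /Jm row_mxKl.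
rewrite (F_eq aW' W'z sV' (J_smooth aW' sY) VJ) (F_J aW' W'z sY) (J_h aW' W'z sY).
by rewrite -VJ.
Qed.

End AlmostComplex.

(** * Curvature of a linear connection *)

Ltac row_ring := apply/rowP => ?; rewrite !mxE; ring.

Section Connection.
Context {R : realType} {m : nat} {T : Type} (A : atlas R m T).
Hypothesis sA : smooth_atlas A.
Variables (O : set T) (D : @vf R m T -> @vf R m T -> @vf R m T).
Hypothesis HD : linear_connection A O D.
Implicit Types (W : set T) (X Y Z : @vf R m T) (f : T -> R^o) (z : T).

Local Notation sm W X := (smooth_vf A W X).
Local Notation op W := (open_in A W /\ W `<=` O).
Local Notation br := (bracket A).
Local Notation K := (curvature A D).

Let sf0 W : smooth_fun A W (fun=> 0 : R^o).
Proof. exact: smooth_fun_cst. Qed.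

Lemma D_smooth W X Y : op W -> sm W X -> sm W Y -> sm W (D X Y).
Proof. by move=> [oW WO] sX sY; have [] := HD oW WO sX sY sY (sf0 W). Qed.

Lemma D_addl W X X' Y z : op W -> W z -> sm W X -> sm W X' -> sm W Y ->
  D (X \+ X') Y z = D X Y z + D X' Y z.
Proof.
by move=> [oW WO] Wz sX sX' sY; have [_ /(_ z Wz)[]] := HD oW WO sX sX' sY (sf0 W).
Qed.

Lemma D_scalel W f X Y z : op W -> W z -> smooth_fun A W f -> sm W X -> sm W Y ->
  D (fscale f X) Y z = f z *: D X Y z.
Proof.
by move=> [oW WO] Wz sf sX sY; have [_ /(_ z Wz)[]] := HD oW WO sX sY sY sf.
Qed.

Lemma D_addr W X Y Y' z : op W -> W z -> sm W X -> sm W Y -> sm W Y' ->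
  D X (Y \+ Y') z = D X Y z + D X Y' z.
Proof.
by move=> [oW WO] Wz sX sY sY'; have [_ /(_ z Wz)[]] := HD oW WO sX sY sY' (sf0 W).
Qed.

Lemma D_leibniz W f X Y z : op W -> W z -> smooth_fun A W f -> sm W X -> sm W Y ->
  D X (fscale f Y) z = act A X f z *: Y z + f z *: D X Y z.
Proof.
by move=> [oW WO] Wz sf sX sY; have [_ /(_ z Wz)[]] := HD oW WO sX sY sY sf.
Qed.

Lemma D_tensorial W Y z : op W -> sm W Y ->
  tensorial_at A W z (fun X => D X Y z).
Proof.
move=> [_ WO] sY W' oW' W'z W'W X X' f sX sX' sf.
have aW' : op W' by split => // w /W'W /WO.
have sY' := smooth_vf_sub W'W sY.
by split; [exact: (D_addl aW')|exact: (D_scalel aW')].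
Qed.

Lemma D_eql W X X' Y z : op W -> W z -> sm W X -> sm W X' -> sm W Y ->
  X z = X' z -> D X Y z = D X' Y z.
Proof.
move=> aW Wz sX sX' sY XX; have [oW _] := aW.
exact: (tensorial_eq sA oW Wz (D_tensorial aW sY)).
Qed.

Lemma D_eql0 W X Y z : op W -> W z -> sm W X -> sm W Y -> X z = 0 -> D X Y z = 0.
Proof.
move=> aW Wz sX sY X0; have [oW _] := aW.
exact: (tensorial0 sA oW Wz (D_tensorial aW sY)).
Qed.

(** In the Leibniz rule for the indicator of fscale_indicator both terms vanish
    on W. *)
Lemma D_local0 W X Y z : op W -> W z -> sm W X -> (forall w, W w -> Y w = 0) ->
  D X Y z = 0.
Proof.
move=> aW Wz sX Y0; have [oW _] := aW; have [f f0 YE] := fscale_indicator Y0.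
have sY := smooth_vf_eq0 sA oW Y0; have sf := smooth_fun_eq0 sA oW f0.
by rewrite YE (D_leibniz aW Wz sf sX sY) (Y0 _ Wz) (f0 _ Wz) scaler0 scale0r addr0.
Qed.

Lemma D_eqr W X Y Y' z : op W -> W z -> sm W X -> sm W Y -> sm W Y' ->
  (forall w, W w -> Y w = Y' w) -> D X Y z = D X Y' z.
Proof.
move=> aW Wz sX sY sY' YY; have [oW _] := aW.
have sYY := smooth_vf_subr sA oW sY sY'.
have YE : Y = Y' \+ (Y \- Y').
  by apply/funext => w; rewrite addvE subvE addrC subrK.
have D0 : D X (Y \- Y') z = 0.
  by apply: (D_local0 aW Wz sX) => w Ww; rewrite subvE (YY _ Ww) subrr.
by rewrite YE (D_addr aW Wz sX sY' sYY) D0 addr0.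
Qed.

Lemma D_subr W X Y Y' z : op W -> W z -> sm W X -> sm W Y -> sm W Y' ->
  D X (Y \- Y') z = D X Y z - D X Y' z.
Proof.
move=> aW Wz sX sY sY'; have [oW _] := aW.
have sYY := smooth_vf_subr sA oW sY sY'.
have YE : Y = (Y \- Y') \+ Y' by apply/funext => w; rewrite addvE subvE subrK.
have := D_addr aW Wz sX sYY sY'; rewrite -YE => ->; by rewrite addrK.
Qed.

Lemma D_subl W X X' Y z : op W -> W z -> sm W X -> sm W X' -> sm W Y ->
  D (X \- X') Y z = D X Y z - D X' Y z.
Proof.
move=> aW Wz sX sX' sY; have [oW _] := aW.
have sXX := smooth_vf_subr sA oW sX sX'.
have XE : X = (X \- X') \+ X' by apply/funext => w; rewrite addvE subvE subrK.
have := D_addl aW Wz sXX sX' sY; rewrite -XE => ->; by rewrite addrK.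
Qed.

Lemma curvatureE X Y Z z :
  K X Y Z z = D X (D Y Z) z - D Y (D X Z) z - D (br X Y) Z z.
Proof. by rewrite /curvature !subvE. Qed.

Lemma curvature_smooth W X Y Z : op W -> sm W X -> sm W Y -> sm W Z ->
  sm W (K X Y Z).
Proof.
move=> aW sX sY sZ; have [oW _] := aW.
have s1 := D_smooth aW sX (D_smooth aW sY sZ).
have s2 := D_smooth aW sY (D_smooth aW sX sZ).
have s3 := D_smooth aW (smooth_bracket sA oW sX sY) sZ.
exact: (smooth_vf_subr sA oW (smooth_vf_subr sA oW s1 s2) s3).
Qed.

Lemma curvatureC W X Y Z z : op W -> W z -> sm W X -> sm W Y -> sm W Z ->
  K X Y Z z = - K Y X Z z.
Proof.
move=> aW Wz sX sY sZ; have [oW _] := aW.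
have sXY := smooth_bracket sA oW sX sY; have sYX := smooth_bracket sA oW sY sX.
have e : D (br X Y) Z z = - D (br Y X) Z z.
  apply/eqP; rewrite -subr_eq0 opprK; apply/eqP.
  rewrite -(D_addl aW Wz sXY sYX sZ).
  apply: (D_eql0 aW Wz (smooth_vf_add sA oW sXY sYX) sZ).
  by rewrite addvE (bracketC A X Y) addNr.
have alg (a b c d : 'rV[R]_m) : c = - d -> a - b - c = - (b - a - d).
  by move=> ->; row_ring.
rewrite (curvatureE X Y) (curvatureE Y X); exact: alg e.
Qed.

(** The term Y(f) D_X Z that comes from the Leibniz rule for D_Y is cancelled by
    the one from the bracket of fX and Y. *)
Lemma curvature_tensorial1 W Y Z z : op W -> sm W Y -> sm W Z ->
  tensorial_at A W z (fun X => K X Y Z z).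
Proof.
move=> [_ WO] sY0 sZ0 W' oW W'z W'W X X' f sX sX' sf.
have aW : op W' by split => // w /W'W /WO.
have sY := smooth_vf_sub W'W sY0; have sZ := smooth_vf_sub W'W sZ0.
have sDYZ := D_smooth aW sY sZ; have sDXZ := D_smooth aW sX sZ.
have sDX'Z := D_smooth aW sX' sZ.
have sXX' := smooth_vf_add sA oW sX sX'; have sfX := smooth_vf_scale sA oW sf sX.
have sXY := smooth_bracket sA oW sX sY; have sX'Y := smooth_bracket sA oW sX' sY.
split.
- have e1 := D_addl aW W'z sX sX' sDYZ.
  have e2 : D Y (D (X \+ X') Z) z = D Y (D X Z \+ D X' Z) z.
    apply: (D_eqr aW W'z sY (D_smooth aW sXX' sZ) (smooth_vf_add sA oW sDXZ sDX'Z)).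
    by move=> w Ww; rewrite (D_addl aW Ww sX sX' sZ) addvE.
  have e3 := D_addr aW W'z sY sDXZ sDX'Z.
  have e4 : D (br (X \+ X') Y) Z z = D (br X Y \+ br X' Y) Z z.
    apply: (D_eql aW W'z (smooth_bracket sA oW sXX' sY)
      (smooth_vf_add sA oW sXY sX'Y) sZ).
    by rewrite addvE (bracketDl sA oW W'z sX sX' sY).
  have e5 := D_addl aW W'z sXY sX'Y sZ.
  have alg (a a1 a2 b b' b1 b2 c c' c1 c2 : 'rV[R]_m) : a = a1 + a2 -> b = b' ->
     b' = b1 + b2 -> c = c' -> c' = c1 + c2 ->
     a - b - c = (a1 - b1 - c1) + (a2 - b2 - c2).
    by move=> -> -> -> -> ->; row_ring.
  rewrite (curvatureE X) (curvatureE X') (curvatureE (X \+ X')).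
  exact: alg e1 e2 e3 e4 e5.
- have sXYf : sm W' (fscale (act A Y f) X).
    exact: (smooth_vf_scale sA oW (smooth_fun_act sA oW sY sf) sX).
  have sfXY := smooth_vf_scale sA oW sf sXY.
  have sYf := smooth_fun_act sA oW sY sf.
  have e1 := D_scalel aW W'z sf sX sDYZ.
  have e2 : D Y (D (fscale f X) Z) z = D Y (fscale f (D X Z)) z.
    apply: (D_eqr aW W'z sY (D_smooth aW sfX sZ) (smooth_vf_scale sA oW sf sDXZ)).
    by move=> w Ww; rewrite (D_scalel aW Ww sf sX sZ) scalevE.
  have e3 := D_leibniz aW W'z sf sY sDXZ.
  have e4 : D (br (fscale f X) Y) Z z = D (fscale f (br X Y) \- fscale (act A Y f) X) Z z.
    apply: (D_eql aW W'z (smooth_bracket sA oW sfX sY)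
      (smooth_vf_subr sA oW sfXY sXYf) sZ).
    by rewrite subvE !scalevE (bracketZl sA oW W'z sf sX sY).
  have e5 := D_subl aW W'z sfXY sXYf sZ.
  have e6 := D_scalel aW W'z sf sXY sZ.
  have e7 := D_scalel aW W'z sYf sX sZ.
  have alg (s t : R) (a a1 b b' b1 b2 c c' c1 c2 c3 : 'rV[R]_m) :
     a = s *: a1 -> b = b' -> b' = t *: b1 + s *: b2 -> c = c' -> c' = c1 - c2 ->
     c1 = s *: c3 -> c2 = t *: b1 -> a - b - c = s *: (a1 - b2 - c3).
    by move=> -> -> -> -> -> -> ->; row_ring.
  rewrite (curvatureE X) (curvatureE (fscale f X)).
  exact: alg e1 e2 e3 e4 e5 e6 e7.
Qed.

Lemma curvature_tensorial2 W X Z z : op W -> sm W X -> sm W Z ->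
  tensorial_at A W z (fun Y => K X Y Z z).
Proof.
move=> aW0 sX0 sZ0 W' oW W'z W'W Y Y' f sY sY' sf.
have [_ WO] := aW0; have aW : op W' by split => // w /W'W /WO.
have sX := smooth_vf_sub W'W sX0; have sZ := smooth_vf_sub W'W sZ0.
have [e1 e2] := curvature_tensorial1 aW0 sX0 sZ0 oW W'z W'W sY sY' sf.
have eC V : sm W' V -> K X V Z z = - K V X Z z.
  by move=> sV; exact: (curvatureC aW W'z sX sV sZ).
have alg1 (a b c a' b' c' : 'rV[R]_m) : a = b + c -> a' = - a -> b' = - b ->
    c' = - c -> a' = b' + c' by move=> -> -> -> ->; rewrite opprD.
have alg2 (s : R) (a b a' b' : 'rV[R]_m) : a = s *: b -> a' = - a -> b' = - b ->
    a' = s *: b' by move=> -> -> ->; rewrite scalerN.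
split; first exact: alg1 e1 (eC _ (smooth_vf_add sA oW sY sY')) (eC _ sY) (eC _ sY').
exact: alg2 e2 (eC _ (smooth_vf_scale sA oW sf sY)) (eC _ sY).
Qed.

(** The terms with one derivative of f cancel in pairs, and the second
    derivatives leave [X,Y] f, which the term D_[X,Y] takes away. *)
Lemma curvature_tensorial3 W X Y z : op W -> sm W X -> sm W Y ->
  tensorial_at A W z (fun Z => K X Y Z z).
Proof.
move=> [_ WO] sX0 sY0 W' oW W'z W'W Z Z' f sZ sZ' sf.
have aW : op W' by split => // w /W'W /WO.
have sX := smooth_vf_sub W'W sX0; have sY := smooth_vf_sub W'W sY0.
have sXY := smooth_bracket sA oW sX sY.
have sDYZ := D_smooth aW sY sZ; have sDYZ' := D_smooth aW sY sZ'.
have sDXZ := D_smooth aW sX sZ; have sDXZ' := D_smooth aW sX sZ'.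
have sZZ' := smooth_vf_add sA oW sZ sZ'; have sfZ := smooth_vf_scale sA oW sf sZ.
split.
- have e1 : D X (D Y (Z \+ Z')) z = D X (D Y Z \+ D Y Z') z.
    apply: (D_eqr aW W'z sX (D_smooth aW sY sZZ') (smooth_vf_add sA oW sDYZ sDYZ')).
    by move=> w Ww; rewrite (D_addr aW Ww sY sZ sZ') addvE.
  have e2 := D_addr aW W'z sX sDYZ sDYZ'.
  have e3 : D Y (D X (Z \+ Z')) z = D Y (D X Z \+ D X Z') z.
    apply: (D_eqr aW W'z sY (D_smooth aW sX sZZ') (smooth_vf_add sA oW sDXZ sDXZ')).
    by move=> w Ww; rewrite (D_addr aW Ww sX sZ sZ') addvE.
  have e4 := D_addr aW W'z sY sDXZ sDXZ'.
  have e5 := D_addr aW W'z sXY sZ sZ'.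
  have alg (a a' a1 a2 b b' b1 b2 c c1 c2 : 'rV[R]_m) : a = a' -> a' = a1 + a2 ->
     b = b' -> b' = b1 + b2 -> c = c1 + c2 ->
     a - b - c = (a1 - b1 - c1) + (a2 - b2 - c2).
    by move=> -> -> -> -> ->; row_ring.
  rewrite (curvatureE _ _ Z) (curvatureE _ _ Z') (curvatureE _ _ (Z \+ Z')).
  exact: alg e1 e2 e3 e4 e5.
- have sXf := smooth_fun_act sA oW sX sf; have sYf := smooth_fun_act sA oW sY sf.
  have half U V : sm W' U -> sm W' V -> smooth_fun A W' (act A V f) ->
      sm W' (D V Z) ->
      D U (D V (fscale f Z)) z = act A U (act A V f) z *: Z z +
        act A V f z *: D U Z z + (act A U f z *: D V Z z + f z *: D U (D V Z) z).
    move=> sU sV sVf sDVZ.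
    have s1 := smooth_vf_scale sA oW sVf sZ.
    have s2 := smooth_vf_scale sA oW sf sDVZ.
    have e1 : D U (D V (fscale f Z)) z =
        D U (fscale (act A V f) Z \+ fscale f (D V Z)) z.
      apply: (D_eqr aW W'z sU (D_smooth aW sV sfZ) (smooth_vf_add sA oW s1 s2)).
      by move=> w Ww; rewrite (D_leibniz aW Ww sf sV sZ) addvE !scalevE.
    have e2 := D_addr aW W'z sU s1 s2.
    have e3 := D_leibniz aW W'z sVf sU sZ.
    have e4 := D_leibniz aW W'z sf sU sDVZ.
    exact: etrans e1 (etrans e2 (congr2 (fun u v : 'rV[R]_m => u + v) e3 e4)).
  have e1 := half X Y sX sY sYf sDYZ.
  have e2 := half Y X sY sX sXf sDXZ.
  have e3 := D_leibniz aW W'z sf sXY sZ.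
  have e4 := act_bracket sA oW sX sY sf W'z.
  have alg (s p q r x y : R) (a b c u a1 a2 a3 b3 c3 : 'rV[R]_m) :
     a = p *: u + y *: a1 + (x *: a2 + s *: a3) ->
     b = q *: u + x *: a2 + (y *: a1 + s *: b3) ->
     c = r *: u + s *: c3 -> r = p - q ->
     a - b - c = s *: (a3 - b3 - c3).
    move=> -> -> -> ->; row_ring.
  rewrite (curvatureE _ _ Z) (curvatureE _ _ (fscale f Z)).
  exact: alg e1 e2 e3 e4.
Qed.

Lemma curvature_eq W X Y Z X' Y' Z' z : op W -> W z ->
  sm W X -> sm W Y -> sm W Z -> sm W X' -> sm W Y' -> sm W Z' ->
  X z = X' z -> Y z = Y' z -> Z z = Z' z -> K X Y Z z = K X' Y' Z' z.
Proof.
move=> aW Wz sX sY sZ sX' sY' sZ' XX YY ZZ; have [oW _] := aW.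
have e1 : K X Y Z z = K X' Y Z z.
  exact: (tensorial_eq sA oW Wz (curvature_tensorial1 (z := z) aW sY sZ)).
have e2 : K X' Y Z z = K X' Y' Z z.
  exact: (tensorial_eq sA oW Wz (curvature_tensorial2 (z := z) aW sX' sZ)).
have e3 : K X' Y' Z z = K X' Y' Z' z.
  exact: (tensorial_eq sA oW Wz (curvature_tensorial3 (z := z) aW sX' sY')).
exact: etrans e1 (etrans e2 e3).
Qed.

Lemma curvature_add1 W X X' Y Z z : op W -> W z ->
  sm W X -> sm W X' -> sm W Y -> sm W Z ->
  K (X \+ X') Y Z z = K X Y Z z + K X' Y Z z.
Proof.
move=> aW Wz sX sX' sY sZ; have [oW _] := aW.
have [e _] := curvature_tensorial1 aW sY sZ oW Wz (@subset_refl _ W) sX sX' (sf0 W).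
exact: e.
Qed.

Lemma curvature_add2 W X Y Y' Z z : op W -> W z ->
  sm W X -> sm W Y -> sm W Y' -> sm W Z ->
  K X (Y \+ Y') Z z = K X Y Z z + K X Y' Z z.
Proof.
move=> aW Wz sX sY sY' sZ; have [oW _] := aW.
have [e _] := curvature_tensorial2 aW sX sZ oW Wz (@subset_refl _ W) sY sY' (sf0 W).
exact: e.
Qed.

Lemma curvature_opp2 W X Y Y' Z z : op W -> W z ->
  sm W X -> sm W Y -> sm W Y' -> sm W Z -> Y z = - Y' z ->
  K X Y Z z = - K X Y' Z z.
Proof.
move=> aW Wz sX sY sY' sZ YE; have [oW _] := aW.
have e := curvature_add2 aW Wz sX sY sY' sZ.
have tZ := curvature_tensorial2 (z := z) aW sX sZ.
have e0 : K X (Y \+ Y') Z z = 0.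
  apply: (tensorial0 sA oW Wz tZ (smooth_vf_add sA oW sY sY')).
  by rewrite addvE YE addNr.
by apply/eqP; rewrite -addr_eq0 -e e0.
Qed.

(** The Jacobi identity for the commutators of D_X, D_Y, D_Z together with the
    one for the bracket of fields. In this form the torsion does not occur. *)
Lemma bianchi2 W X Y Z V z : op W -> W z ->
  sm W X -> sm W Y -> sm W Z -> sm W V ->
  (D X (K Y Z V) z - K Y Z (D X V) z + K X (br Y Z) V z) +
  (D Y (K Z X V) z - K Z X (D Y V) z + K Y (br Z X) V z) +
  (D Z (K X Y V) z - K X Y (D Z V) z + K Z (br X Y) V z) = 0.
Proof.
move=> aW Wz sX sY sZ sV; have [oW _] := aW.
have E U1 U2 U3 : sm W U1 -> sm W U2 -> sm W U3 ->
    D U1 (K U2 U3 V) z - K U2 U3 (D U1 V) z + K U1 (br U2 U3) V z =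
    D U1 (D U2 (D U3 V)) z - D U1 (D U3 (D U2 V)) z -
    (D U2 (D U3 (D U1 V)) z - D U3 (D U2 (D U1 V)) z) -
    D (br U1 (br U2 U3)) V z.
  move=> s1 s2 s3; have s23 := smooth_bracket sA oW s2 s3.
  have sD U : sm W U -> sm W (D U V) by move=> sU; exact: (D_smooth aW sU sV).
  have sa := D_smooth aW s2 (sD _ s3); have sb := D_smooth aW s3 (sD _ s2).
  have sc := D_smooth aW s23 sV.
  have e1 := D_subr aW Wz s1 (smooth_vf_subr sA oW sa sb) sc.
  have e2 := D_subr aW Wz s1 sa sb.
  have e3 := curvatureE U2 U3 (D U1 V) z.
  have e4 := curvatureE U1 (br U2 U3) V z.
  have alg (p q r p' p1 p2 p3 q1 q2 q3 r3 : 'rV[R]_m) : p = p' - p3 -> p' = p1 - p2 ->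
      q = q1 - q2 - q3 -> r = p3 - q3 - r3 ->
      p - q + r = p1 - p2 - (q1 - q2) - r3.
    move=> -> -> -> ->; row_ring.
  exact: alg e1 e2 e3 e4.
have sb1 := smooth_bracket sA oW sX (smooth_bracket sA oW sY sZ).
have sb2 := smooth_bracket sA oW sY (smooth_bracket sA oW sZ sX).
have sb3 := smooth_bracket sA oW sZ (smooth_bracket sA oW sX sY).
have sb12 := smooth_vf_add sA oW sb1 sb2.
have j1 : D (br X (br Y Z) \+ br Y (br Z X) \+ br Z (br X Y)) V z = 0.
  apply: (D_eql0 aW Wz (smooth_vf_add sA oW sb12 sb3) sV).
  by rewrite !addvE (bracket_jacobi sA oW Wz sX sY sZ).
have j2 := D_addl aW Wz sb12 sb3 sV.
have j3 := D_addl aW Wz sb1 sb2 sV.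
have alg (t1 t2 t3 a b c d e g u u' u1 u2 u3 : 'rV[R]_m) : u = 0 -> u = u' + u3 ->
    u' = u1 + u2 ->
    t1 = a - b - (c - d) - u1 -> t2 = c - e - (g - b) - u2 ->
    t3 = g - d - (a - e) - u3 -> t1 + t2 + t3 = 0.
  move=> -> E1 E2 -> -> ->; rewrite E2 in E1; apply/rowP => i.
  move/rowP/(_ i): E1; rewrite !mxE => E1.
  transitivity (- (u1 0 i + u2 0 i + u3 0 i)); first ring.
  by rewrite -E1 oppr0.
exact: alg j1 j2 j3 (E _ _ _ sX sY sZ) (E _ _ _ sY sZ sX) (E _ _ _ sZ sX sY).
Qed.

End Connection.

(** * The Cartan connection and the nullity of P *)

Section Cartan.
Context {R : realType} {n : nat} {M : Type} (A : atlas R n M).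
Hypothesis sA : smooth_atlas A.
Let TM := tvec R n M.
Let TA := tatlas A.
Let sTA : smooth_atlas TA := tangent_atlas sA.
Let field := @vf R (n + n) TM.
Variables (S : field) (F : field -> field) (C1 C2 D0 D : field -> field -> field).
Hypotheses (sS : smooth_vf TA slit S) (HF : almost_complex A S F).
Hypotheses (HC1 : sym_semibasic A C1) (HC2 : sym_semibasic A C2).
Hypotheses (HD0 : berwald A S F D0) (HD : cartan A S F D0 C1 C2 D).

Local Notation sm W X := (smooth_vf TA W X).
Local Notation h := (hproj A S).
Local Notation v := (vproj A S).
Local Notation br := (bracket TA).
Local Notation op W := (slit_open A W).
Local Notation K := (curvature TA D).
Local Notation J := (@Jt R n M).
Implicit Types (W : set TM) (X Y Z V : field) (z : TM).

Let HDl : linear_connection TA slit D. Proof. by case: HD. Qed.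

Lemma C1_smooth W X Y : op W -> sm W X -> sm W Y -> sm W (C1 X Y).
Proof.
move=> [oW Ws] sX sY; case: HC1 => H _.
by have [] := H W oW Ws X Y Y (fun=> 0) sX sY sY (smooth_fun_cst W (0 : R^o)).
Qed.

Lemma C1C W X Y z : op W -> W z -> sm W X -> sm W Y -> C1 X Y z = C1 Y X z.
Proof.
move=> [oW Ws] Wz sX sY; case: HC1 => H _.
by have [_ _ _ ->] := H W oW Ws X Y Y (fun=> 0) sX sY sY (smooth_fun_cst W (0 : R^o)).
Qed.

Lemma D_vertical W X Y z : op W -> W z -> sm W X -> sm W Y ->
  D (J X) (J Y) z = J (br (J X) Y) z + C1 X Y z.
Proof.
move=> [oW Ws] Wz sX sY; case: HD => _ _ H.
have [-> _] := H W oW Ws X Y sX sY z Wz; congr (_ + _).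
by case: HD0 => _ _ H0; have [] := H0 W oW Ws X Y sX sY z Wz.
Qed.

Lemma J_D_vertical W X Y z : op W -> W z -> sm W X -> sm W Y ->
  Jm (D (J X) (J Y) z) = 0.
Proof.
move=> aW Wz sX sY; rewrite (D_vertical aW Wz sX sY) Jm_add JtE Jm_Jm add0r -JtE.
have [oW Ws] := aW; case: HC1 => _ H.
by have [] := H W oW Ws X Y sX sY z Wz.
Qed.

Lemma J_D_horizontal W X Y z : op W -> W z -> sm W X -> sm W Y ->
  Jm (D (h X) (J Y) z) = 0.
Proof.
move=> aW Wz sX sY; have [oW Ws] := aW; case: HD => _ _ H.
have [_ ->] := H W oW Ws X Y sX sY z Wz.
have -> : D0 (h X) (J Y) z = v (br (h X) (J Y)) z.
  by case: HD0 => _ _ H0; have [] := H0 W oW Ws X Y sX sY z Wz.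
have sb := smooth_bracket sTA oW (h_smooth sA HF aW sX) (J_smooth sA aW sY).
rewrite Jm_add (J_v sA sS HF aW Wz sb) add0r -JtE.
by case: HC2 => _ H2; have [] := H2 W oW Ws X Y sX sY z Wz.
Qed.

(** The vertical part of X written in the form J of a smooth field, so that the
    defining formulas of D, which concern derivatives of fields JY in directions
    hX and JX, apply to it. *)
Lemma hv_split W X z : op W -> W z -> sm W X ->
  X z = (h X \+ J (F (v X))) z.
Proof.
move=> aW Wz sX; rewrite addvE JtE.
rewrite (J_F_vertical sA sS HF aW Wz (v_smooth sA HF aW sX) (J_v sA sS HF aW Wz sX)).
by rewrite vE addrC subrK.
Qed.

(** D_A JY is vertical both for A = hX and for A = JX, and these directions span. *)
Lemma J_D_J W X Y z : op W -> W z -> sm W X -> sm W Y -> Jm (D X (J Y) z) = 0.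
Proof.
move=> aW Wz sX sY; have [oW _] := aW.
have shX := h_smooth sA HF aW sX.
have sF := F_smooth HF aW (v_smooth sA HF aW sX).
have sJF := J_smooth sA aW sF; have sJY := J_smooth sA aW sY.
have e1 := D_eql sTA HDl aW Wz sX (smooth_vf_add sTA oW shX sJF) sJY (hv_split aW Wz sX).
rewrite e1 (D_addl HDl aW Wz shX sJF sJY) Jm_add.
by rewrite (J_D_horizontal aW Wz sX sY) (J_D_vertical aW Wz sF sY) addr0.
Qed.

Lemma D_F W X Y z : op W -> W z -> sm W X -> sm W Y -> D X (F Y) z = F (D X Y) z.
Proof. by move=> [oW Ws] Wz sX sY; case: HD => _ H _; exact: (H W oW Ws X Y sX sY z Wz). Qed.

(** D_X commutes with F, and by J_D_J it preserves the vertical bundle. So in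
    Y = FJY + (vertical) the second term disappears under J, and the first one
    contributes JF D_X JY = D_X JY. *)
Lemma J_parallel W X Y z : op W -> W z -> sm W X -> sm W Y ->
  J (D X Y) z = D X (J Y) z.
Proof.
move=> aW Wz sX sY; have [oW _] := aW.
have shY := h_smooth sA HF aW sY; have svY := v_smooth sA HF aW sY.
have sF := F_smooth HF aW svY; have sJF := J_smooth sA aW sF.
have sJY := J_smooth sA aW sY; have sD := D_smooth HDl aW sX sJY.
have sFJ := F_smooth HF aW sJY.
have sum := smooth_vf_add sTA oW sFJ sJF.
have e1 : D X Y z = D X (F (J Y) \+ J (F (v Y))) z.
  apply: (D_eqr sTA HDl aW Wz sX sY sum) => w Ww.
  by rewrite (hv_split aW Ww sY) !addvE (F_J HF aW Ww sY).
rewrite JtE e1 (D_addr HDl aW Wz sX sFJ sJF) Jm_add.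
rewrite (J_D_J aW Wz sX sF) addr0 (D_F aW Wz sX sJY).
exact: (J_F_vertical sA sS HF aW Wz sD (J_D_J aW Wz sX sY)).
Qed.

Lemma horizontal_h z a : slit z -> horizontal A S z a -> h (ext TA z a) z = a.
Proof.
move=> sz [b ab]; have os := slit_open_in sA.
have aS : op (slit : set TM) by split.
have [W [aW Wz _ Wc]] := slit_open_dom sA aS sz.
have sa : sm W (ext TA z a) by apply: smooth_vf_sub (smooth_ext sTA z a).
have sb : sm W (ext TA z b) by apply: smooth_vf_sub (smooth_ext sTA z b).
have shb := h_smooth sA HF aW sb.
have E : ext TA z a z = h (ext TA z b) z by rewrite (ext_id sTA) -ab.
by rewrite (h_eq sA HF aW Wz sa shb E) (h_h sA sS HF aW Wz sb) -ab.
Qed.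

Lemma nullity_h W X z : op W -> W z -> sm W X -> nullity_P A S D z (X z) ->
  h X z = X z.
Proof.
move=> aW Wz sX [ha _]; have [oW Ws] := aW.
have [W' [aW' W'z W'W W'c]] := slit_open_dom sA aW Wz.
have se : sm W' (ext TA z (X z)) by apply: smooth_vf_sub (smooth_ext sTA z _).
rewrite -[RHS](horizontal_h (Ws _ Wz) ha).
apply: (h_eq sA HF aW' W'z (smooth_vf_sub W'W sX) se).
by rewrite (ext_id sTA).
Qed.

(** The nullity space is tested on fields with constant components in a chart;
    by tensoriality any other smooth fields with these values will do. *)
Lemma hv_curvature_ext W X Y Z z : op W -> W z -> sm W X -> sm W Y -> sm W Z ->
  h X z = X z ->
  hv_curvature A S D (ext TA z (X z)) (ext TA z (Y z)) (ext TA z (Z z)) z =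
  K X (J Y) (J Z) z.
Proof.
move=> aW Wz sX sY sZ hX.
have [W' [aW' W'z W'W W'c]] := slit_open_dom sA aW Wz.
have se a : sm W' (ext TA z a) by apply: smooth_vf_sub (smooth_ext sTA z a).
have [sX' sY' sZ'] := And3 (smooth_vf_sub W'W sX) (smooth_vf_sub W'W sY)
  (smooth_vf_sub W'W sZ).
apply: (curvature_eq sTA HDl aW' W'z (h_smooth sA HF aW' (se _))
  (J_smooth sA aW' (se _)) (J_smooth sA aW' (se _)) sX' (J_smooth sA aW' sY')
  (J_smooth sA aW' sZ')).
- rewrite -[RHS]hX; apply: (h_eq sA HF aW' W'z (se _) sX'); exact: (ext_id sTA).
- by apply: Jt_pt; exact: (ext_id sTA).
- by apply: Jt_pt; exact: (ext_id sTA).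
Qed.

Lemma nullity_curvature W X Y Z z : op W -> W z -> sm W X -> sm W Y -> sm W Z ->
  nullity_P A S D z (X z) -> K X (J Y) (J Z) z = 0.
Proof.
move=> aW Wz sX sY sZ NX; have hX := nullity_h aW Wz sX NX.
rewrite -(hv_curvature_ext aW Wz sX sY sZ hX); case: NX => _; exact.
Qed.

(** When hX = X and hY = Y each term of [h,h] is [X,Y] or h[X,Y] up to sign. *)
Lemma barthel_curvature_horizontal W X Y z : op W -> W z -> sm W X -> sm W Y ->
  (forall w, W w -> h X w = X w) -> (forall w, W w -> h Y w = Y w) ->
  barthel_curvature A S X Y z = - (br X Y z - h (br X Y) z).
Proof.
move=> aW Wz sX sY hX hY; have [oW _] := aW.
have [shX shY] := conj (h_smooth sA HF aW sX) (h_smooth sA HF aW sY).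
have sb := smooth_bracket sTA oW sX sY.
have same w : W w -> X w = X w by [].
have same' w : W w -> Y w = Y w by [].
have e1 := bracket_eq sTA oW Wz hX hY.
have e2 := h_h sA sS HF aW Wz sb.
have e3 : h (br X (h Y)) z = h (br X Y) z.
  apply: (h_eq sA HF aW Wz (smooth_bracket sTA oW sX shY) sb).
  exact: (bracket_eq sTA oW Wz same hY).
have e4 : h (br (h X) Y) z = h (br X Y) z.
  apply: (h_eq sA HF aW Wz (smooth_bracket sTA oW shX sY) sb).
  exact: (bracket_eq sTA oW Wz hX same').
have alg (a b a' a2 b2 b3 b4 : 'rV[R]_(n + n)) :
    a' = a -> b2 = b -> b3 = b -> b4 = b ->
    - 2^-1 *: (a' + a' + b2 + b2 - b3 - b4 - b3 - b4) = - (a - b).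
  move=> -> -> -> ->; rewrite scaleNr; congr (- _).
  by rewrite -[RHS]half_double; congr (_ *: _); row_ring.
rewrite /barthel_curvature /fn_bracket. have E := alg _ _ _ (br X Y z) _ _ _ e1 e2 e3 e4.
exact E.
Qed.

(** From X = FJX and DF = 0, D_JZ X = F D_JZ JX = h[JZ,X] + FC(X,Z). *)
Lemma h_D_vertical W X Z z : op W -> W z -> sm W X -> sm W Z ->
  (forall w, W w -> h X w = X w) ->
  h (D (J Z) X) z = h (br (J Z) X) z + h (F (C1 X Z)) z.
Proof.
move=> aW Wz sX sZ hX; have [oW _] := aW.
have sJZ := J_smooth sA aW sZ; have sJX := J_smooth sA aW sX.
have sb := smooth_bracket sTA oW sJZ sX; have shb := h_smooth sA HF aW sb.
have sJb := J_smooth sA aW sb.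
have sCZ := C1_smooth aW sZ sX; have sCX := C1_smooth aW sX sZ.
have sFC := F_smooth HF aW sCX; have sD := D_smooth HDl aW sJZ sX.
have sDJ := D_smooth HDl aW sJZ sJX; have sFJ := F_smooth HF aW sJX.
have e : D (J Z) X z = (h (br (J Z) X) \+ F (C1 X Z)) z.
  have e1 : D (J Z) X z = D (J Z) (F (J X)) z.
    apply: (D_eqr sTA HDl aW Wz sJZ sX sFJ) => w Ww.
    by rewrite (F_J HF aW Ww sX) (hX _ Ww).
  rewrite e1 (D_F aW Wz sJZ sJX) addvE.
  rewrite (F_eq sA HF aW Wz sDJ (smooth_vf_add sTA oW sJb sCZ)); last first.
    by rewrite addvE (D_vertical aW Wz sZ sX).
  rewrite (F_add HF aW Wz sJb sCZ) (F_J HF aW Wz sb).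
  by rewrite (F_eq sA HF aW Wz sCZ sCX (C1C aW Wz sZ sX)).
rewrite (h_eq sA HF aW Wz sD (smooth_vf_add sTA oW shb sFC) e).
by rewrite (h_add sA HF aW Wz shb sFC) (h_h sA sS HF aW Wz sb).
Qed.

(** * The mixed Bianchi identity *)

Section MixedBianchi.
Variables (W : set TM) (X Y Z V : field) (z : TM).
Hypotheses (aW : op W) (Wz : W z).
Hypotheses (sX : sm W X) (sY : sm W Y) (sZ : sm W Z) (sV : sm W V).
Hypotheses (NX : forall w, W w -> nullity_P A S D w (X w)).
Hypotheses (NY : forall w, W w -> nullity_P A S D w (Y w)).

Let oW : open_in TA W. Proof. by case: aW. Qed.
Let sJZ : sm W (J Z). Proof. exact: (J_smooth sA aW sZ). Qed.
Let sJV : sm W (J V). Proof. exact: (J_smooth sA aW sV). Qed.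
Let hX w : W w -> h X w = X w.
Proof. by move=> Ww; exact: (nullity_h aW Ww sX (NX Ww)). Qed.
Let hY w : W w -> h Y w = Y w.
Proof. by move=> Ww; exact: (nullity_h aW Ww sY (NY Ww)). Qed.

Let K_nullity_vertical U V' B : sm W U ->
  (forall w, W w -> nullity_P A S D w (U w)) -> sm W V' -> sm W B ->
  Jm (B z) = 0 -> K U (J V') B z = 0.
Proof.
move=> sU NU sV' sB B0; have sFB := F_smooth HF aW sB.
have BE : B z = J (F B) z by rewrite JtE (J_F_vertical sA sS HF aW Wz sB B0).
rewrite (curvature_eq sTA HDl aW Wz sU (J_smooth sA aW sV') sB sU
  (J_smooth sA aW sV') (J_smooth sA aW sFB) erefl erefl BE).
exact: (nullity_curvature aW Wz sU sV' sFB (NU _ Wz)).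
Qed.

Let K_nullity_h U B : sm W U -> (forall w, W w -> nullity_P A S D w (U w)) ->
  sm W B -> K U B (J V) z = K U (h B) (J V) z.
Proof.
move=> sU NU sB; have shB := h_smooth sA HF aW sB.
have sF := F_smooth HF aW (v_smooth sA HF aW sB); have sJF := J_smooth sA aW sF.
rewrite (curvature_eq sTA HDl aW Wz sU sB sJV sU (smooth_vf_add sTA oW shB sJF)
  sJV erefl (hv_split aW Wz sB) erefl).
rewrite (curvature_add2 sTA HDl aW Wz sU shB sJF sJV).
by rewrite (nullity_curvature aW Wz sU sF sV (NU _ Wz)) addr0.
Qed.

(** bianchi2 on X, Y, JZ, applied to JV. The terms where X or Y is paired with a
    vertical field vanish. In the remaining ones only the horizontal part
    h[JZ,X] of a bracket counts, and h_D_vertical turns it into the argument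
    D_JZ X of R minus FC(X,Z). So the covariant derivative of R and the Cartan
    terms absorb everything but the value on [X,Y]. *)
Lemma mixed_bianchi :
  cov_deriv D (h_curvature A S D) (J Z) X Y V z -
  (h_curvature A S D Y (F (C1 X Z)) V z - h_curvature A S D X (F (C1 Y Z)) V z) =
  K (br X Y) (J Z) (J V) z.
Proof.
have shX := h_smooth sA HF aW sX; have shY := h_smooth sA HF aW sY.
have sXY := smooth_bracket sTA oW sX sY.
have sbX := smooth_bracket sTA oW sJZ sX; have sbY := smooth_bracket sTA oW sJZ sY.
have sYb := smooth_bracket sTA oW sY sJZ.
have shbX := h_smooth sA HF aW sbX; have shbY := h_smooth sA HF aW sbY.
have sFX := F_smooth HF aW (C1_smooth aW sX sZ).
have sFY := F_smooth HF aW (C1_smooth aW sY sZ).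
have shFX := h_smooth sA HF aW sFX; have shFY := h_smooth sA HF aW sFY.
have sDX := D_smooth HDl aW sJZ sX; have sDY := D_smooth HDl aW sJZ sY.
have shDX := h_smooth sA HF aW sDX; have shDY := h_smooth sA HF aW sDY.
have sDV := D_smooth HDl aW sJZ sV; have sJDV := J_smooth sA aW sDV.
have sDJV := D_smooth HDl aW sJZ sJV.
have KC U U' : sm W U -> sm W U' -> K U U' (J V) z = - K U' U (J V) z.
  by move=> sU sU'; exact: (curvatureC sTA HDl aW Wz sU sU' sJV).
(* In bianchi2 the following vanish because X and Y are null, or lose the
   vertical part of their bracket for the same reason. *)
have b := bianchi2 sTA HDl aW Wz sX sY sJZ sJV.
have K0 U : sm W U -> (forall w, W w -> nullity_P A S D w (U w)) ->
    forall w, W w -> K U (J Z) (J V) w = 0.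
  by move=> sU NU w Ww; exact: (nullity_curvature aW Ww sU sZ sV (NU _ Ww)).
have b1 : D X (K Y (J Z) (J V)) z = 0.
  exact: (D_local0 sTA HDl aW Wz sX (K0 _ sY NY)).
have b2 : K Y (J Z) (D X (J V)) z = 0.
  apply: (K_nullity_vertical sY NY sZ (D_smooth HDl aW sX sJV)).
  exact: (J_D_J aW Wz sX sV).
have b3 : K X (br Y (J Z)) (J V) z = - K X (h (br (J Z) Y)) (J V) z.
  rewrite -(K_nullity_h sX NX sbY).
  exact: (curvature_opp2 sTA HDl aW Wz sX sYb sbY sJV (bracketC TA Y (J Z) z)).
have b4 : D Y (K (J Z) X (J V)) z = 0.
  apply: (D_local0 sTA HDl aW Wz sY) => w Ww.
  by rewrite (curvatureC sTA HDl aW Ww sJZ sX sJV) (K0 _ sX NX w Ww) oppr0.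
have b5 : K (J Z) X (D Y (J V)) z = 0.
  have sDYV := D_smooth HDl aW sY sJV.
  rewrite (curvatureC sTA HDl aW Wz sJZ sX sDYV).
  by rewrite (K_nullity_vertical sX NX sZ sDYV (J_D_J aW Wz sY sV)) oppr0.
have b6 := K_nullity_h sY NY sbX.
have b7 := KC _ _ sJZ sXY.
(* R depends on h of its first two arguments; X and Y are horizontal, and
   h_D_vertical computes the others. *)
have c1 : D (J Z) (h_curvature A S D X Y V) z = D (J Z) (K X Y (J V)) z.
  have sK := curvature_smooth sTA HDl aW sX sY sJV.
  have shK := curvature_smooth sTA HDl aW shX shY sJV.
  apply: (D_eqr sTA HDl aW Wz sJZ shK sK) => w Ww.
  exact: (curvature_eq sTA HDl aW Ww shX shY sJV sX sY sJV (hX Ww) (hY Ww) erefl).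
have c2 : h_curvature A S D (D (J Z) X) Y V z =
    K (h (br (J Z) X)) Y (J V) z + K (h (F (C1 X Z))) Y (J V) z.
  rewrite -(curvature_add1 sTA HDl aW Wz shbX shFX sY sJV).
  apply: (curvature_eq sTA HDl aW Wz shDX shY sJV (smooth_vf_add sTA oW shbX shFX)
    sY sJV _ (hY Wz) erefl).
  by rewrite addvE; exact: (h_D_vertical aW Wz sX sZ hX).
have c3 : h_curvature A S D X (D (J Z) Y) V z =
    K X (h (br (J Z) Y)) (J V) z + K X (h (F (C1 Y Z))) (J V) z.
  rewrite -(curvature_add2 sTA HDl aW Wz sX shbY shFY sJV).
  apply: (curvature_eq sTA HDl aW Wz shX shDY sJV sX (smooth_vf_add sTA oW shbY shFY)
    sJV (hX Wz) _ erefl).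
  by rewrite addvE; exact: (h_D_vertical aW Wz sY sZ hY).
have c4 : h_curvature A S D X Y (D (J Z) V) z = K X Y (D (J Z) (J V)) z.
  exact: (curvature_eq sTA HDl aW Wz shX shY sJDV sX sY sDJV (hX Wz) (hY Wz)
    (J_parallel aW Wz sJZ sV)).
have r1 : h_curvature A S D Y (F (C1 X Z)) V z = K Y (h (F (C1 X Z))) (J V) z.
  exact: (curvature_eq sTA HDl aW Wz shY shFX sJV sY shFX sJV (hY Wz) erefl erefl).
have r2 : h_curvature A S D X (F (C1 Y Z)) V z = K X (h (F (C1 Y Z))) (J V) z.
  exact: (curvature_eq sTA HDl aW Wz shX shFY sJV sX shFY sJV (hX Wz) erefl erefl).
have s1 := KC _ _ shbX sY; have s2 := KC _ _ shFX sY.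
have alg (x1 x2 x3 y1 y2 y3 y3' z1 z2 z3 kb d d2 d3 d4 u1 u2 w1 w2 q1 q2 yf :
    'rV[R]_(n + n)) :
  x1 = 0 -> x2 = 0 -> x3 = - w1 -> y1 = 0 -> y2 = 0 -> y3 = y3' -> z3 = - kb ->
  d = z1 -> d2 = u1 + u2 -> d3 = w1 + w2 -> d4 = z2 ->
  q1 = yf -> q2 = w2 -> u1 = - y3' -> u2 = - yf ->
  x1 - x2 + x3 + (y1 - y2 + y3) + (z1 - z2 + z3) = 0 ->
  d - d2 - d3 - d4 - (q1 - q2) = kb.
  move=> -> -> -> -> -> -> -> -> -> -> -> -> -> -> -> => E.
  apply/eqP; rewrite -subr_eq0 -E; apply/eqP; row_ring.
rewrite /cov_deriv !subvE.
exact: alg b1 b2 b3 b4 b5 b6 b7 c1 c2 c3 c4 r1 r2 s1 s2 b.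
Qed.

End MixedBianchi.

End Cartan.

(** * Integrability of the nullity distribution *)

Theorem theorem5p5 (R : realType) (n : nat) (M : topologicalType)
    (A : atlas R n M) (HM : smooth_manifold A)
    (E : tvec R n M -> R^o) (HE : finsler A E)
    (S : vf (tvec R n M)) (HS : canonical_spray A E S)
    (F : vf (tvec R n M) -> vf (tvec R n M)) (HF : almost_complex A S F)
    (C1 C2 D0 D : vf (tvec R n M) -> vf (tvec R n M) -> vf (tvec R n M))
    (HC1 : first_cartan A E F C1) (HC2 : second_cartan A E S F C2)
    (HD0 : berwald A S F D0) (HD : cartan A S F D0 C1 C2 D)
    (U : set (tvec R n M)) (HU : open_in (tatlas A) U) (HUs : U `<=` slit)
    (Hmu : exists k : nat, forall z, U z -> nullity_index_P A S D z k) :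
  completely_integrable (tatlas A) (nullity_P A S D) U <->
  (forall X Y : vf (tvec R n M),
     section_on (tatlas A) (nullity_P A S D) U X ->
     section_on (tatlas A) (nullity_P A S D) U Y ->
     (forall z, U z -> barthel_curvature A S X Y z = 0) /\
     (forall Z : vf (tvec R n M), smooth_vf (tatlas A) slit Z ->
      forall W : vf (tvec R n M), smooth_vf (tatlas A) U W ->
      forall z, U z ->
        cov_deriv D (h_curvature A S D) (Jt Z) X Y W z =
        h_curvature A S D Y (F (C1 X Z)) W z
        - h_curvature A S D X (F (C1 Y Z)) W z)).
Proof.
have sA := manifold_atlas HM; have sTA := tangent_atlas sA.
case: HS => sS _; case: HC1 => hC1 _; case: HC2 => hC2 _.
have aU : slit_open A U by [].
have slitT : slit `<=` (setT : set (tvec R n M)) by [].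
have UT : U `<=` (setT : set (tvec R n M)) by [].
have sec X : section_on (tatlas A) (nullity_P A S D) U X ->
    forall z, U z -> hproj A S X z = X z.
  by case=> sX NX z Uz; exact: (nullity_h sA sS HF aU Uz sX (NX z Uz)).
split=> [int X Y secX secY|H X Y secX secY].
  have [sX NX] := secX; have [sY NY] := secY.
  have secXY := int X Y secX secY; have [sXY NXY] := secXY.
  split=> [z Uz|Z sZ V sV z Uz].
    have curvE := barthel_curvature_horizontal sA sS HF aU Uz sX sY (sec X secX)
      (sec Y secY).
    by rewrite curvE (sec _ secXY z Uz) subrr oppr0.
  have sZU : smooth_vf (tatlas A) U Z by exact: smooth_vf_sub sZ.
  have bianchiE := mixed_bianchi sA sS HF hC1 hC2 HD0 HD aU Uz sX sY sZU sV NX NY.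
  have P0 := nullity_curvature sA sS HF HD aU Uz sXY sZU sV (NXY z Uz).
  by apply/eqP; rewrite -subr_eq0; apply/eqP; exact: etrans bianchiE P0.
have [sX NX] := secX; have [sY NY] := secY; have [curv0 bianchi] := H X Y secX secY.
have sXY := smooth_bracket sTA HU sX sY.
split=> [|z Uz]; first exact: sXY.
have hXY : hproj A S (bracket (tatlas A) X Y) z = bracket (tatlas A) X Y z.
  have curvE := barthel_curvature_horizontal sA sS HF aU Uz sX sY (sec X secX)
    (sec Y secY).
  by apply/esym/eqP; rewrite -subr_eq0 -oppr_eq0 -curvE (curv0 z Uz).
split.
  exists (bracket (tatlas A) X Y z).
  have [W [aW Wz WU Wc]] := slit_open_dom sA aU Uz.
  rewrite -[LHS]hXY; apply: (h_eq sA HF aW Wz (smooth_vf_sub WU sXY)).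
    exact: (smooth_vf_sub Wc (smooth_ext sTA z _)).
  by rewrite (ext_id sTA).
move=> b c; have [Z sZ Zz] := global_extension HM z b.
have [V sV Vz] := global_extension HM z c.
have [sZU sVU] := conj (smooth_vf_sub UT sZ) (smooth_vf_sub UT sV).
have bianchiE := mixed_bianchi sA sS HF hC1 hC2 HD0 HD aU Uz sX sY sZU sVU NX NY.
rewrite -Zz -Vz (hv_curvature_ext sA HF HD aU Uz sXY sZU sVU hXY) -bianchiE.
by apply/eqP; rewrite subr_eq0; apply/eqP;
  exact: (bianchi Z (smooth_vf_sub slitT sZ) V sVU z Uz).
Qed.
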